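(* Let $E$ be a separable Banach space. (1) If $E$ is finite-dimensional and polyhedral, then $S_n(E)$ is metrically separable (i.e., separable with respect to its distance $d$) for every $n$. (2) Otherwise, $S_n(E)$ has metric density character (i.e., density character with respect to $d$) equal to the continuum for every $n \geq 1$.
   Context: All spaces are real. For a Banach space $E$ and $n \in \mathbb{N}$, let $E(n) = E \oplus \bigoplus_{i<n} \mathbb{R} x_i$, with formal variables $x_i$. The space of $n$-types $S_n(E)$ is the set of all semi-norms on $E(n)$ extending the norm of $E$. If $E \subseteq F$ are Banach spaces (isometric inclusion) and $\bar a \in F^n$, then $\mathrm{tp}(\bar a/E) \in S_n(E)$ is the semi-norm $b + \sum \lambda_i x_i \mapsto \| b + \sum \lambda_i a_i \|$; $\bar a$ realises $\xi$ if $\xi = \mathrm{tp}(\bar a/E)$. The distance $d(\xi,\zeta)$ on $S_n(E)$ is the infimum, over all Banach spaces $F \supseteq E$ and all realisations $\bar a,\bar b \in F^n$ of $\xi,\zeta$ respectively, of $\sup_i \|a_i - b_i\|$. A finite-dimensional normed space is polyhedral if its unit ball is a polytope. The density character of a metric space is the least cardinality of a dense subset. *)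

(* Defs.v *)
From HB Require Import structures.
From mathcomp Require Import all_boot all_order all_algebra.
From mathcomp Require Import all_classical all_reals all_analysis.

Set Implicit Arguments.
Unset Strict Implicit.
Unset Printing Implicit Defensive.

Import Order.TTheory GRing.Theory Num.Theory.
Import numFieldNormedType.Exports.

Local Open Scope classical_set_scope.
Local Open Scope card_scope.
Local Open Scope ring_scope.

Section linear_notions.
Variables (R : realType).

Definition finite_dimensional (V : lmodType R) : Prop :=
  exists (m : nat) (e : 'I_m -> V),
    forall x, exists c : 'I_m -> R, x = \sum_(i < m) c i *: e i.

Definition convex_hull (V : lmodType R) (m : nat) (v : 'I_m -> V) : set V :=
  [set x | exists c : 'I_m -> R,
    [/\ forall i, 0 <= c i, \sum_(i < m) c i = 1
      & x = \sum_(i < m) c i *: v i]].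

Definition polytope (V : lmodType R) (A : set V) : Prop :=
  exists (m : nat) (v : 'I_m -> V), A = convex_hull v.

Definition polyhedral (V : normedModType R) : Prop :=
  polytope [set x : V | `|x| <= 1].

Definition seminorm (V : lmodType R) (p : V -> R) : Prop :=
  [/\ forall x, 0 <= p x,
      forall x y, p (x + y) <= p x + p y
    & forall (t : R) x, p (t *: x) = `|t| * p x].

End linear_notions.

Definition separable_space (T : topologicalType) : Prop :=
  exists2 D : set T, countable D & dense D.

(* A metric space is given here as a set S with a distance dist on S; the
   ambient type T may contain other points, on which dist is irrelevant. *)
Section metric_density.
Variables (R : realType) (T : Type) (S : set T) (dist : T -> T -> \bar R).

Definition metrically_dense (D : set T) : Prop :=
  D `<=` S /\
  forall x, S x -> forall e : R, 0 < e -> exists2 y, D y & (dist x y < e%:E)%E.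

Definition metrically_separable : Prop :=
  exists2 D : set T, countable D & metrically_dense D.

(* The least cardinality of a dense subset is the cardinality of K. *)
Definition metric_density_character_is (U : Type) (K : set U) : Prop :=
  (exists2 D : set T, metrically_dense D & D #= K) /\
  forall D : set T, metrically_dense D -> K #<= D.

End metric_density.

Section types.
Variables (R : realType) (E : completeNormedModType R) (n : nat).

(* (b, l) stands for the formal sum b + \sum_i l_i x_i. *)
Definition formal_ext : lmodType R := (E * 'rV[R]_n)%type.

Definition ntypes : set (formal_ext -> R) :=
  [set p | seminorm p /\ forall b : E, p (b, 0) = `|b|].

Definition isometric (F : completeNormedModType R) (j : E -> F) : Prop :=
  forall x, `|j x| = `|x|.

Definition tp (F : completeNormedModType R) (j : {linear E -> F})
    (a : 'I_n -> F) : formal_ext -> R :=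
  fun u => `|j u.1 + \sum_(i < n) u.2 0 i *: a i|.

(* The infimum is taken in \bar R, where inf set0 = +oo: a real-valued inf of
   an empty set would be 0. *)
Definition type_dist (xi zeta : formal_ext -> R) : \bar R :=
  ereal_inf [set r | exists (F : completeNormedModType R)
      (j : {linear E -> F}) (a b : 'I_n -> F),
    [/\ isometric j, tp j a = xi, tp j b = zeta
      & r = (\big[Num.max/0]_(i < n) `|a i - b i|)%:E]].

End types.

(* Main.v *)
From HB Require Import structures.
Require Import Defs.
From mathcomp Require Import all_boot all_order all_algebra.
From mathcomp Require Import all_classical all_reals all_analysis.
From mathcomp Require Import ring lra.

(** A type is a seminorm on [E(n)], and the distance between two types is their
    largest difference relative to the l1 norm of the coefficients of the
    variables.  One inequality is the triangle inequality in a common extension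
    ([type_dist_lt]).  The other ([type_dist_le]) amalgamates the two types by an
    explicit seminorm on the sum of two copies of [E(n)] glued along [E], which
    is then realised in a Banach space: evaluation at the dominated linear
    functionals embeds a seminormed space into bounded functions, and the
    Hahn-Banach theorem makes the embedding isometric
    ([seminorm_realization]).  From then on one only compares seminorms.

    Suppose that the unit ball of [E] is the hull of [v_1, ..., v_m].  Any [b] is
    a combination of the [v_i] with nonnegative coefficients of sum [`|b|].
    Along such combinations a type minus the sum of the coefficients is
    non-increasing in each coefficient and bounded below.  Rounding coefficients
    and values to a grid turns a type into a non-increasing map from tuples of
    natural numbers to natural numbers, once the coefficients of the variables
    are treated in the same way.  By a form of Dickson's lemma there are only
    countably many such maps ([countable_antitone]), and types with the same
    rounding are close ([type_code_close]), so one representative for each mesh,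
    each bound on the variables and each map give a countable dense set.

    Suppose now that [E] is separable and not of this kind.  By Mazur's theorem
    the points with a unique norming functional are dense ([smooth_dense]).  If
    their norming functionals were finite in number, they would compute the norm
    and the unit ball would be a polytope
    ([finitely_many_norming_polyhedral]).  So there are infinitely many, and weak-*
    compactness of the dual ball extracts functionals [psi_m] and points [c_m]
    such that [psi_m] norms [c_m] while the other [psi_j] are at most
    [`|c_m| - 1] there ([separated_functionals]).  For a set [S] of natural
    numbers, the seminorm
    [max (`|b|) (sup_(m in S) `|psi_m b + l|)] is a type of one variable, and
    different sets give types at distance at least [1], so each element of a dense
    set is near at most one of them ([type_of_set_far]) and the dense set has at
    least continuum many elements.  Conversely a type
    is determined by its values on a countable set, so there are at most continuum
    many types ([card_types_le_real]). *)

Set Implicit Arguments.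
Unset Strict Implicit.
Unset Printing Implicit Defensive.

Import Order.TTheory GRing.Theory Num.Theory.
Import numFieldNormedType.Exports.

Local Open Scope classical_set_scope.
Local Open Scope ring_scope.
Local Open Scope card_scope.

(** * Dominated linear functionals *)

Section hahn_banach.
Variables (R : realType) (V : lmodType R).
Implicit Types (p q f : V -> R) (x y v : V).

Definition sublinear p :=
  (forall x y, p (x + y) <= p x + p y) /\
  (forall t x, 0 <= t -> p (t *: x) = t * p x).

Definition linear_below p f :=
  (forall t x y, f (t *: x + y) = t * f x + f y) /\ (forall x, f x <= p x).

Section linear_below_theory.
Variables (p f : V -> R) (fp : linear_below p f).

Lemma linear_below0 : f 0 = 0.
Proof. by have := fp.1 1 0 0; rewrite scaler0 addr0 mul1r; lra. Qed.

Lemma linear_belowZ t x : f (t *: x) = t * f x.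
Proof. by have := fp.1 t x 0; rewrite addr0 linear_below0 addr0. Qed.

Lemma linear_belowD x y : f (x + y) = f x + f y.
Proof. by have := fp.1 1 x y; rewrite scale1r mul1r. Qed.

Lemma linear_belowN x : f (- x) = - f x.
Proof. by rewrite -scaleN1r linear_belowZ mulN1r. Qed.

Lemma linear_belowB x y : f (x - y) = f x - f y.
Proof. by rewrite linear_belowD linear_belowN. Qed.

Lemma linear_below_norm x : seminorm p -> `|f x| <= p x.
Proof.
move=> [_ _ pZ]; rewrite ler_norml fp.2 andbT lerNl -linear_belowN.
by have := fp.2 (- x); rewrite -(scaleN1r x) pZ normrN1 mul1r.
Qed.

End linear_below_theory.

Lemma sublinear0 p : sublinear p -> p 0 = 0.
Proof. by move=> [_ pZ]; rewrite -(scale0r (0 : V)) pZ// mul0r. Qed.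

Lemma sublinear_ge p x : sublinear p -> - p (- x) <= p x.
Proof.
move=> sp; have [pD _] := sp; have := pD x (- x).
by rewrite subrr sublinear0//; lra.
Qed.

Lemma seminorm_sublinear p : seminorm p -> sublinear p.
Proof. by move=> [p0 pD pZ]; split=> // t x t0; rewrite pZ ger0_norm. Qed.

(** The largest sublinear functional below [p] that takes the value [- p v],
    or less, at [- v]; a linear functional below it agrees with [p] at [v]. *)
Definition slide p v x : R :=
  inf [set p (x + t *: v) - t * p v | t in [set t | 0 <= t]].

Lemma slide_lbound p v x : sublinear p ->
  lbound [set p (x + t *: v) - t * p v | t in [set t | 0 <= t]] (- p (- x)).
Proof.
move=> [pD pZ] _ [t /= t0 <-].
have := pD (x + t *: v) (- x); rewrite addrAC subrr add0r pZ//; lra.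
Qed.

Lemma slide_le_at p v x t : sublinear p -> 0 <= t ->
  slide p v x <= p (x + t *: v) - t * p v.
Proof.
move=> sp t0; apply: ge_inf; last by exists t.
by exists (- p (- x)); exact: slide_lbound.
Qed.

Lemma slide_ge p v x (c : R) : 
  (forall t, 0 <= t -> c <= p (x + t *: v) - t * p v) -> c <= slide p v x.
Proof.
move=> H; apply: lb_le_inf; last by move=> _ [t /= t0 <-]; exact: H.
by exists (p (x + 0 *: v) - 0 * p v); exists 0 => //=.
Qed.

Lemma slide_le p v x : sublinear p -> slide p v x <= p x.
Proof.
by move=> sp; have := slide_le_at v x sp (lexx 0);
  rewrite scale0r addr0 mul0r subr0.
Qed.

Lemma slide_opp p v : sublinear p -> slide p v (- v) <= - p v.
Proof.
move=> sp; have := slide_le_at v (- v) sp ler01.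
by rewrite scale1r addNr sublinear0// mul1r sub0r.
Qed.

Lemma slide_sublinear p v : sublinear p -> sublinear (slide p v).
Proof.
move=> sp; have [pD pZ] := sp.
have s0 x t s : 0 <= t -> 0 <= s -> slide p v x <= p (x + (t + s) *: v) - (t + s) * p v.
  by move=> t0 s0; apply: slide_le_at => //; exact: addr_ge0.
split=> [x y|t x].
  rewrite -lerBlDr; apply: slide_ge => t t0.
  rewrite lerBlDr -lerBlDl; apply: slide_ge => s s_ge0.
  rewrite lerBlDl; apply: le_trans (s0 _ _ _ t0 s_ge0) _.
  have -> : x + y + (t + s) *: v = (x + t *: v) + (y + s *: v).
    by rewrite scalerDl addrACA.
  have := pD (x + t *: v) (y + s *: v); lra.
rewrite le_eqVlt => /predU1P[<-|t0].
  rewrite scale0r mul0r; apply/le_anti/andP; split.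
    by rewrite (le_trans (slide_le _ _ sp))// sublinear0.
  by apply: slide_ge => s s_ge0; rewrite add0r pZ// subrr.
have dir u y : 0 < u -> slide p v (u *: y) <= u * slide p v y.
  move=> u0; rewrite -ler_pdivrMl//; apply: slide_ge => s s_ge0.
  rewrite ler_pdivrMl// mulrBr mulrA -pZ ?(ltW u0)// scalerDr scalerA.
  by apply: slide_le_at => //; rewrite mulr_ge0// ltW.
apply/le_anti/andP; split; first exact: dir.
rewrite -ler_pdivlMl//; apply: le_trans (dir _ _ _); rewrite ?invr_gt0//.
by rewrite scalerA mulVf ?gt_eqF// scale1r.
Qed.

(** A minimal [q] equals each [slide q v], hence [q x + q v <= q (x + v)]: this
    replaces the one-dimensional extension step of the usual argument. *)
Lemma minimal_sublinear_linear q : sublinear q ->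
  (forall q', sublinear q' -> (forall x, q' x <= q x) -> q' = q) ->
  linear_below q q.
Proof.
move=> sq qmin; have [qD qZ] := sq; split=> // t x y.
have E v : slide q v = q.
  by apply: qmin; [exact: slide_sublinear|move=> x'; exact: slide_le].
have add a b : q (a + b) = q a + q b.
  apply/le_anti; rewrite qD/= -lerBrDr -{1}(E b).
  by have := slide_le_at b a sq ler01; rewrite scale1r mul1r.
have opp a : q (- a) = - q a.
  by apply/eqP; rewrite -addr_eq0 addrC -add subrr sublinear0.
rewrite add; congr (_ + _); have [t0|t0] := leP 0 t; first exact: qZ.
by rewrite -[t]opprK scaleNr opp qZ ?mulNr// oppr_ge0 ltW.
Qed.

(** Zorn's lemma: the values at [x] of the sublinear functionals below [p] are
    bounded below by [- p (- x)], so a chain has a pointwise infimum. *)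
Lemma minimal_sublinear_exists p : sublinear p -> exists q,
  [/\ sublinear q, (forall x, q x <= p x) &
      forall q', sublinear q' -> (forall x, q' x <= q x) -> q' = q].
Proof.
move=> sp; pose P q := sublinear q /\ forall x, q x <= p x; pose T := {q : V -> R | P q}.
pose le_T (s t : T) := `[< forall x, sval t x <= sval s x >].
have [||||[q [sq qp]] qmin] := @Zorn T le_T.
- by move=> t; apply/asboolP.
- move=> r s t /asboolP rs /asboolP st; apply/asboolP => x.
  exact: le_trans (st x) (rs x).
- move=> [s ps] [t pt] /asboolP/= st /asboolP/= ts.
  by apply: eq_exist; apply/funext => x; apply/le_anti; rewrite ts st.
- move=> A totA; have [[q0 Aq0]|A0] := pselect (A !=set0); last first.
    by exists (exist P p (conj sp (fun=> lexx _))) => s As; exfalso; apply: A0; exists s.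
  pose I x := [set sval q x | q in A].
  have lbI x : lbound (I x) (- p (- x)).
    move=> _ [[q [sq qp]] _ <-]/=; apply: le_trans (sublinear_ge _ sq).
    by rewrite lerN2.
  have I0 x : I x !=set0 by exists (sval q0 x), q0.
  have infI x (q : T) : A q -> inf (I x) <= sval q x.
    by move=> Aq; apply: ge_inf; [exists (- p (- x)); exact: lbI|exists q].
  have ge_infI x c : (forall q : T, A q -> c <= sval q x) -> c <= inf (I x).
    by move=> H; apply: lb_le_inf => // _ [q Aq <-]; exact: H.
  suff si : sublinear (fun x => inf (I x)).
    have sip x : inf (I x) <= p x.
      by apply: le_trans (infI x _ Aq0) _; case: q0 {Aq0} => ? [].
    exists (exist P _ (conj si sip)) => s As; apply/asboolP => x /=.
    exact: infI.
  split=> [x y|t x t0].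
    rewrite -lerBlDr; apply: (ge_infI) => q Aq.
    rewrite lerBlDr -lerBlDl; apply: (ge_infI) => q' Aq'.
    rewrite lerBlDl; have [/asboolP qq'|/asboolP q'q] := totA _ _ Aq Aq'.
      apply: le_trans (infI _ _ Aq') _.
      have [[qD _] _] := svalP q'; apply: le_trans (qD _ _) _.
      by rewrite lerD2r.
    apply: le_trans (infI _ _ Aq) _.
    have [[qD _] _] := svalP q; apply: le_trans (qD _ _) _.
    by rewrite lerD2l.
  have dir u y : 0 <= u -> u * inf (I y) <= inf (I (u *: y)).
    move=> u0; apply: (ge_infI) => q Aq; have [[_ qZ] _] := svalP q.
    by rewrite qZ// ler_wpM2l// infI.
  apply/le_anti; rewrite dir// andbT.
  case: (ltrgt0P t) t0 => // [t0 _|-> _]; last first.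
    rewrite scale0r mul0r; apply: le_trans (infI _ _ Aq0) _.
    by have [sq _] := svalP q0; rewrite sublinear0.
  rewrite -ler_pdivrMl//; apply: le_trans (dir _ _ _) _.
    by rewrite invr_ge0 ltW.
  by rewrite scalerA mulVf ?gt_eqF// scale1r.
exists q; split=> // q' sq' q'q.
have q'p x : q' x <= p x by apply: le_trans (q'q x) (qp x).
have := qmin (exist P q' (conj sq' q'p)); rewrite /le_T/=.
by move=> /(_ (asboolT q'q)) [].
Qed.

(** A minimal functional is taken below [slide p v] rather than below [p], to
    attain the value of [p] at [v]. *)
Lemma hahn_banach p v : sublinear p ->
  exists2 f, linear_below p f & f v = p v.
Proof.
move=> sp; have [q [sq qp qmin]] :=
  minimal_sublinear_exists (slide_sublinear v sp).
have [qlin _] := minimal_sublinear_linear sq qmin.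
have qp' x : q x <= p x by apply: le_trans (qp x) (slide_le v x sp).
exists q => //; apply/le_anti; rewrite qp'/=.
have := sublinear_ge v sq; have := le_trans (qp (- v)) (slide_opp v sp); lra.
Qed.

End hahn_banach.

(** * Realisation of seminorms in Banach spaces *)

Section bounded_functions.
Variables (R : realType) (X : Type).

Definition bounded_pred : pred (X -> R) :=
  [pred f | `[< exists M : R, forall x, `|f x| <= M >]].

Record bfun := BFun { bval :> X -> R; _ : bounded_pred bval }.
HB.instance Definition _ := [isSub for bval].
HB.instance Definition _ := [Choice of bfun by <:].

Fact bounded_submod : GRing.submod_closed bounded_pred.
Proof.
split=> [|t f g /asboolP[M fM] /asboolP[N gN]]; apply/asboolP.
  by exists 0 => x; rewrite normr0.
exists (`|t| * M + N) => x; apply: le_trans (ler_normD _ _) _.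
by rewrite lerD// normrM ler_wpM2l.
Qed.

HB.instance Definition _ :=
  GRing.isSubmodClosed.Build R (X -> R) bounded_pred bounded_submod.
HB.instance Definition _ := [SubChoice_isSubLmodule of bfun by <:].

Implicit Types (f g : bfun) (M c t : R).

(** An infimum of upper bounds rather than a supremum of values, so that an
    empty [X] needs no separate treatment. *)
Definition sup_norm (f : bfun) : R :=
  inf [set M | 0 <= M /\ forall x, `|f x| <= M].

Lemma sup_norm_le f M : 0 <= M -> (forall x, `|f x| <= M) -> sup_norm f <= M.
Proof. by move=> M0 fM; apply: ge_inf => //; exists 0 => ? []. Qed.

Lemma sup_norm_ge f c : (forall M, 0 <= M -> (forall x, `|f x| <= M) -> c <= M) ->
  c <= sup_norm f.
Proof.
move=> H; apply: lb_le_inf; last by move=> M [M0 fM]; exact: H.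
case: f {H} => f /=/asboolP[M fM]; exists (Num.max 0 M) => /=.
by split=> [|x]; rewrite le_max ?lexx// fM orbT.
Qed.

Lemma le_sup_norm (f : bfun) x : `|f x| <= sup_norm f.
Proof. by apply: sup_norm_ge => M _; apply. Qed.

Lemma sup_norm_ge0 f : 0 <= sup_norm f.
Proof. exact: sup_norm_ge. Qed.

Lemma sup_normD f g : sup_norm (f + g) <= sup_norm f + sup_norm g.
Proof.
apply: sup_norm_le => [|x]; first by rewrite addr_ge0// sup_norm_ge0.
by apply: le_trans (ler_normD _ _) _; rewrite lerD// le_sup_norm.
Qed.

Lemma sup_normZ t f : sup_norm (t *: f) = `|t| * sup_norm f.
Proof.
have dir s g : sup_norm (s *: g) <= `|s| * sup_norm g.
  apply: sup_norm_le => [|x]; first by rewrite mulr_ge0// sup_norm_ge0.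
  by rewrite normrM ler_wpM2l// le_sup_norm.
apply/le_anti; rewrite dir/=; have [->|t0] := eqVneq t 0.
  by rewrite normr0 mul0r sup_norm_ge0.
rewrite -ler_pdivlMl ?normr_gt0// -normfV; apply: le_trans (dir _ _).
by rewrite scalerA mulVf// scale1r.
Qed.

Lemma sup_norm0_eq0 f : sup_norm f = 0 -> f = 0.
Proof.
move=> f0; apply/val_inj/funext => x; apply/eqP.
by rewrite -normr_le0 -f0 le_sup_norm.
Qed.

HB.instance Definition _ :=
  Lmodule_isNormed.Build R bfun sup_normD sup_normZ sup_norm0_eq0.

(** The limit is taken pointwise; the uniform bounds of the Cauchy condition
    pass to it. *)
Lemma bfun_complete (F : set_system bfun) : ProperFilter F -> cauchy F -> cvg F.
Proof.
move=> FF /cauchyP Fc.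
have dist f g x : `|f x - g x| <= `|f - g|.
  exact: (le_sup_norm (f - g) x).
have cvgx x : cvg ((fun f : bfun => f x) @ F).
  apply: cauchy_cvg; apply/cauchyP => e /Fc[f Ff]; exists (f x).
  apply: (@filterS _ F _ (ball f e) _ _ Ff) => g.
  rewrite /preimage/= -!ball_normE/= => fg.
  exact: le_lt_trans (dist f g x) fg.
pose g x : R := lim ((fun f : bfun => f x) @ F).
have gle (f : bfun) e x : F (ball f e) -> `|g x - f x| <= e.
  move=> Fe; apply/ler_addgt0Pr => d d0; near F => h.
  have gh : `|g x - h x| < d.
    by near: h; move/cvgrPdist_lt: (cvgx x) => /(_ d d0).
  have : ball f e h by near: h.
  rewrite -ball_normE/= => fh; apply: le_trans (ler_distD (h x) _ _) _.
  by have := dist f h x; rewrite (distrC (h x)); lra.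
have gb : bounded_pred g.
  have [f Ff] := Fc 1 ltr01; apply/asboolP; exists (1 + `|f|) => x.
  rewrite -(subrK (f x) (g x)); apply: le_trans (ler_normD _ _) _.
  by rewrite lerD ?gle// le_sup_norm.
apply/cvg_ex; exists (BFun gb); apply/cvgrPdist_le => e e0.
have [|f Ff] := Fc (e / 2); first by rewrite divr_gt0.
near=> h; rewrite -(subrK f (BFun gb)) -addrA.
apply: le_trans (ler_normD _ _) _; rewrite [leRHS]splitr lerD//.
  by apply: sup_norm_le => [|x]; [rewrite divr_ge0// ltW|exact: gle].
have : ball f (e / 2) h by near: h.
by rewrite -ball_normE/= => /ltW.
Unshelve. all: by end_near. Qed.

HB.instance Definition _ := Uniform_isComplete.Build bfun bfun_complete.

End bounded_functions.

(** The evaluations at the functionals dominated by [p] embed [V] into bounded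
    functions; by Hahn-Banach the supremum norm restricts to [p]. *)
Lemma seminorm_realization (R : realType) (V : lmodType R) (p : V -> R) :
  seminorm p -> exists (F : completeNormedModType R) (J : {linear V -> F}),
    forall v, `|J v| = p v.
Proof.
move=> sp; have [p0 pD pZ] := sp.
pose X := {f : V -> R | linear_below p f}.
have abs (f : X) v : `|sval f v| <= p v.
  by case: f => f' fp; exact: linear_below_norm fp _ sp.
have bd v : bounded_pred (fun f : X => sval f v).
  by apply/asboolP; exists (p v) => f; exact: abs.
pose J v : bfun R X := BFun (bd v).
have Jlin : linear J.
  by move=> t x y; apply/val_inj/funext => -[f [flin fp]] /=; exact: flin.
pose JM := GRing.isLinear.Build R V (bfun R X) *:%R J Jlin.
pose JL : {linear V -> bfun R X} := HB.pack J JM.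
exists (bfun R X), JL => v.
apply/le_anti/andP; split; first by apply: sup_norm_le => // f; exact: abs.
have [f fp fv] := hahn_banach v (seminorm_sublinear sp).
rewrite -fv (le_trans (ler_norm _))//.
exact: (le_sup_norm (J v) (exist _ f fp)).
Qed.

(** * The distance between types *)

Section quotient_seminorm.
Variables (R : realType) (W V : lmodType R) (P : W -> R) (f : {linear W -> V}).
Hypothesis sP : seminorm P.
Hypothesis f_surj : forall v, exists w, f w = v.

(** Types are glued by such a quotient of a direct sum. *)
Definition quotient_seminorm v : R := inf [set P w | w in [set w | f w = v]].

Lemma quotient_seminorm_le w : quotient_seminorm (f w) <= P w.
Proof.
have [P0 _ _] := sP; apply: ge_inf; last by exists w.
by exists 0 => _ [w' _ <-].
Qed.

Lemma quotient_seminorm_ge v c :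
  (forall w, f w = v -> c <= P w) -> c <= quotient_seminorm v.
Proof.
move=> H; apply: lb_le_inf; last by move=> _ [w fw <-]; exact: H.
by have [w fw] := f_surj v; exists (P w), w.
Qed.

Lemma quotient_seminormP : seminorm quotient_seminorm.
Proof.
have [P0 PD PZ] := sP; split=> [v|x y|t x].
- by apply: quotient_seminorm_ge => w _.
- rewrite -lerBlDr; apply: quotient_seminorm_ge => w <-.
  rewrite lerBlDr -lerBlDl; apply: quotient_seminorm_ge => w' <-.
  rewrite lerBlDl -linearD; apply: le_trans (PD w w').
  exact: quotient_seminorm_le.
have dir s v : quotient_seminorm (s *: v) <= `|s| * quotient_seminorm v.
  have [->|s0] := eqVneq s 0.
    have [w _] := f_surj v; rewrite scale0r normr0 mul0r -(linear0 f).
    rewrite (le_trans (quotient_seminorm_le _))//.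
    by rewrite -(scale0r w) PZ normr0 mul0r.
  rewrite -ler_pdivrMl ?normr_gt0//; apply: quotient_seminorm_ge => w <-.
  rewrite ler_pdivrMl ?normr_gt0// -PZ -linearZ; exact: quotient_seminorm_le.
apply/le_anti; rewrite dir/=; have [->|t0] := eqVneq t 0.
  by rewrite normr0 mul0r; apply: quotient_seminorm_ge.
rewrite -ler_pdivlMl ?normr_gt0// -normfV; apply: le_trans (dir _ _).
by rewrite scalerA mulVf// scale1r.
Qed.

End quotient_seminorm.

Section type_distance.
Variables (R : realType) (E : completeNormedModType R) (n : nat).
Implicit Types (xi zeta : formal_ext E n -> R) (u : formal_ext E n).

Definition l1norm (l : 'rV[R]_n) : R := \sum_(i < n) `|l 0 i|.

Lemma l1norm_ge0 l : 0 <= l1norm l.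
Proof. exact: sumr_ge0. Qed.

Lemma l1normD l m : l1norm (l + m) <= l1norm l + l1norm m.
Proof.
by rewrite -big_split/= ler_sum// => i _; rewrite mxE ler_normD.
Qed.

Lemma l1normZ t l : l1norm (t *: l) = `|t| * l1norm l.
Proof. by rewrite mulr_sumr; apply: eq_bigr => i _; rewrite mxE normrM. Qed.

Lemma l1norm0 : l1norm 0 = 0.
Proof. by rewrite -(scale0r (0 : 'rV_n)) l1normZ normr0 mul0r. Qed.

Lemma l1normN l : l1norm (- l) = l1norm l.
Proof. by rewrite -scaleN1r l1normZ normrN1 mul1r. Qed.

Lemma l1norm_delta i : l1norm (delta_mx 0 i) = 1.
Proof.
rewrite /l1norm (bigD1 i)//= mxE !eqxx/= normr1 big1 ?addr0// => j ji.
by rewrite mxE (negbTE ji) andbF normr0.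
Qed.

Lemma type_dist_lt xi zeta (r : R) u : (type_dist xi zeta < r%:E)%E ->
  `|xi u - zeta u| <= r * l1norm u.2.
Proof.
move=> /ereal_inf_lt[_ [F [j [a [b [_ <- <- ->]]]]]]; rewrite lte_fin => mr.
rewrite /tp; apply: le_trans (ler_dist_dist _ _) _.
rewrite opprD addrACA subrr add0r -sumrB.
apply: le_trans (ler_norm_sum _ _ _) _; rewrite mulr_sumr ler_sum// => i _.
rewrite -scalerBr normrZ mulrC ler_wpM2r// ltW// (le_lt_trans _ mr)//.
exact: (le_bigmax _ (fun i => `|a i - b i|)).
Qed.

(** On the sum of two copies of [E(n)] glued along [E], take the largest seminorm
    below both types for which the copies of each variable lie within [r] of
    each other.  It restricts to the given types, because a detour through the
    other copy gains no more than it costs. *)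
Lemma type_dist_le xi zeta (r : R) : ntypes xi -> ntypes zeta -> 0 <= r ->
  (forall u, `|xi u - zeta u| <= r * l1norm u.2) ->
  (type_dist xi zeta <= r%:E)%E.
Proof.
move=> [sxi xiE] [szeta zetaE] r0 xizeta.
have [xi0 xiD xiZ] := sxi; have [zeta0 zetaD zetaZ] := szeta.
pose W : lmodType R := (formal_ext E n * formal_ext E n * 'rV[R]_n)%type.
pose V : lmodType R := (E * 'rV[R]_n * 'rV[R]_n)%type.
(* The third component of [W] moves weight from one copy of a variable to the
   other, at the price [r]. *)
pose P (w : W) : R := xi w.1.1 + zeta w.1.2 + r * l1norm w.2.
have sP : seminorm P.
  split=> [w|w w'|t w].
  - by rewrite !addr_ge0// mulr_ge0// l1norm_ge0.
  - have := xiD w.1.1 w'.1.1; have := zetaD w.1.2 w'.1.2.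
    have := ler_wpM2l r0 (l1normD w.2 w'.2); rewrite /P/=; lra.
  - by rewrite /P/= xiZ zetaZ l1normZ; ring.
pose f (w : W) : V := (w.1.1.1 + w.1.2.1, w.1.1.2 + w.2, w.1.2.2 - w.2).
have flin : linear f.
  move=> t w w'; congr (_, _, _) => /=.
  - by rewrite scalerDr addrACA.
  - by rewrite scalerDr addrACA.
  - by rewrite scalerBr opprD addrACA.
pose fM := GRing.isLinear.Build R W V *:%R f flin.
pose fL : {linear W -> V} := HB.pack f fM.
have fsurj v : exists w, fL w = v.
  case: v => -[b l] m; exists ((b, l), (0, m), 0) => /=.
  by rewrite /f/= !addr0 subr0.
have [F [J JE]] := seminorm_realization (quotient_seminormP sP fsurj).
pose inc (b : E) : V := (b, 0, 0).
have jlin : linear (fun b => J (inc b)).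
  by move=> t x y; rewrite -linearP; congr (J _); congr (_, _, _);
    rewrite /= scaler0 addr0.
pose jM := GRing.isLinear.Build R E F *:%R (fun b => J (inc b)) jlin.
pose j : {linear E -> F} := HB.pack (fun b => J (inc b)) jM.
pose a i := J (0, delta_mx 0 i, 0); pose b i := J (0, 0, delta_mx 0 i).
have Ja u : `|J (u.1, u.2, 0)| = xi u.
  case: u => b0 l0; rewrite JE; apply/le_anti/andP; split.
    have := quotient_seminorm_le fL sP ((b0, l0), 0, 0).
    rewrite /= /f/= !addr0 subr0 => /le_trans; apply.
    have -> : P ((b0, l0), 0, 0) = xi (b0, l0) + zeta (0, 0) + r * l1norm 0 by [].
    by rewrite zetaE normr0 l1norm0 mulr0 !addr0.
  apply: (quotient_seminorm_ge fsurj) => -[[[b1 l1] [b2 l2]] l3] [<- <- /eqP].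
  rewrite subr_eq0 => /eqP ->; rewrite /P/=.
  have := xizeta (b2, l3); rewrite ler_distl/= => /andP[_].
  have := xiD (b1, l1) (b2, l3).
  rewrite -[(b1, l1) + _]/(b1 + b2, l1 + l3); lra.
have Jb u : `|J (u.1, 0, u.2)| = zeta u.
  case: u => b0 l0; rewrite JE; apply/le_anti/andP; split.
    have := quotient_seminorm_le fL sP (0, (b0, l0), 0).
    rewrite /= /f/= !add0r subr0 => /le_trans; apply.
    have -> : P (0, (b0, l0), 0) = xi (0, 0) + zeta (b0, l0) + r * l1norm 0 by [].
    by rewrite xiE normr0 l1norm0 mulr0 add0r addr0.
  apply: (quotient_seminorm_ge fsurj) => -[[[b1 l1] [b2 l2]] l3] [<- /eqP].
  rewrite addr_eq0 => /eqP -> <-; rewrite /P/=.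
  have := xizeta (b1, - l3); rewrite ler_distlC/= => /andP[_].
  rewrite l1normN.
  have := zetaD (b1, - l3) (b2, l2).
  rewrite -[(b1, - l3) + _]/(b1 + b2, - l3 + l2) [- l3 + l2]addrC; lra.
have row_sum (G : 'I_n -> V) (l : 'rV[R]_n) :
    \sum_(i < n) l 0 i *: J (G i) = J (\sum_(i < n) l 0 i *: G i).
  by rewrite linear_sum; apply: eq_bigr => i _; rewrite linearZ.
have max_le : \big[Num.max/0]_(i < n) `|a i - b i| <= r.
  apply: bigmax_le => // i _; rewrite -linearB JE.
  have := quotient_seminorm_le fL sP (0, 0, delta_mx 0 i).
  have -> : P (0, 0, delta_mx 0 i) =
      xi (0, 0) + zeta (0, 0) + r * l1norm (delta_mx 0 i) by [].
  rewrite xiE zetaE normr0 l1norm_delta mulr1 !add0r => /(le_trans _); apply.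
  suff -> : (0, delta_mx 0 i, 0) - (0, 0, delta_mx 0 i) =
    fL (0, 0, delta_mx 0 i) :> V by [].
  by congr (_, _, _); rewrite /= ?subr0 ?add0r// !oppr0.
have sum_fst (I : finType) (G : I -> V) :
    \sum_i G i = (\sum_i (G i).1.1, \sum_i (G i).1.2, \sum_i (G i).2).
  by rewrite [LHS]surjective_pairing [(\sum_i G i).1]surjective_pairing !raddf_sum.
have sum1 (l : 'rV[R]_n) :
    \sum_(i < n) l 0 i *: (0, delta_mx 0 i, 0) = (0, l, 0) :> V.
  rewrite sum_fst; congr (_, _, _); last by rewrite big1// => i _; exact: scaler0.
    by rewrite big1// => i _; exact: scaler0.
  by rewrite [RHS]row_sum_delta.
have sum2 (l : 'rV[R]_n) :
    \sum_(i < n) l 0 i *: (0, 0, delta_mx 0 i) = (0, 0, l) :> V.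
  rewrite sum_fst; congr (_, _, _); last by rewrite [RHS]row_sum_delta.
    by rewrite big1// => i _; exact: scaler0.
  by rewrite big1// => i _; exact: scaler0.
apply: le_trans (_ : (\big[Num.max/0]_(i < n) `|a i - b i|)%:E <= _)%E; last first.
  by rewrite lee_fin.
apply: ereal_inf_lbound; exists F, j, a, b; split=> //.
- by move=> x; rewrite -xiE -Ja.
- apply/funext => u; rewrite /tp row_sum sum1 -Ja; congr `|_|.
  by rewrite -[j _]/(J _) -linearD; congr (J (_, _, _)); rewrite /= ?addr0 ?add0r.
- apply/funext => u; rewrite /tp row_sum sum2 -Jb; congr `|_|.
  by rewrite -[j _]/(J _) -linearD; congr (J (_, _, _)); rewrite /= ?addr0 ?add0r.
Qed.

End type_distance.

(** * Non-increasing maps on tuples of natural numbers *)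

Section antitone_maps.
Variable J : finType.
Implicit Types (H : (J -> nat) -> nat) (s t : J -> nat) (A : {set J}).

Definition antitone H := forall s t, (forall j, (s j <= t j)%N) -> (H t <= H s)%N.

Definition truncate T t : J -> nat := fun j => minn (t j) T.

Lemma antitone_truncate_le H T T' t : antitone H -> (T <= T')%N ->
  (H (truncate T t) <= H t)%N -> (H (truncate T' t) <= H t)%N.
Proof.
move=> aH TT' /(leq_trans _); apply; apply: aH => j.
by rewrite /truncate leq_min geq_minl (leq_trans (geq_minr _ _)).
Qed.

(** A form of Dickson's lemma.  On the translated orthant above a point where
    [H] is minimal, [H] is constant; the complement of that orthant is a finite
    union of slices with one coordinate fixed, to which induction applies. *)
Lemma antitone_slice_stable H A s : antitone H -> exists T, forall t,
  (forall j, j \notin A -> t j = s j) -> (H (truncate T t) <= H t)%N.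
Proof.
move=> aH; have [k] := ubnP #|A|; elim: k => // k IH in A s *; rewrite ltnS => Ak.
pose slice t := forall j, j \notin A -> t j = s j.
have [a sa amin] : exists2 a, slice a & forall t, slice t -> (H a <= H t)%N.
  have ex : exists m, `[< exists2 a, slice a & H a = m >].
    by exists (H s); apply/asboolP; exists s.
  case: (ex_minnP ex) => m /asboolP[a sa <-] mmin; exists a => // t st.
  by apply: mmin; apply/asboolP; exists t.
pose fix_at i c j := if j == i then c else s j.
have /choice[T HT] : forall x : J * nat, exists T, x.1 \in A -> forall t,
    (forall j, j \notin A :\ x.1 -> t j = fix_at x.1 x.2 j) ->
    (H (truncate T t) <= H t)%N.
  move=> [i c] /=; have [iA|] := boolP (i \in A); last by exists 0%N.
  have [|T HT] := IH (A :\ i) (fix_at i c); last by exists T.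
  by apply: leq_trans Ak; rewrite [in ltnRHS](cardsD1 i) iA.
exists (\max_j a j + \max_i \max_(c < a i) T (i, val c))%N => t st.
have [/forallP ta|/forallPn[i]] := boolP [forall j, (a j <= t j)%N].
  apply: leq_trans (amin t st); apply: aH => j; rewrite leq_min ta/=.
  by apply: leq_trans (leq_addr _ _); exact: (leq_bigmax j).
rewrite -ltnNge => tia; have iA : i \in A.
  by apply: contraLR tia => iA; rewrite st// sa// ltnn.
apply: (antitone_truncate_le aH) (HT (i, t i) iA t _).
  apply: leq_trans (leq_addl _ _).
  apply: leq_trans (leq_bigmax i).
  exact: (leq_bigmax (Ordinal tia)).
move=> j; rewrite !inE /fix_at; have [->|ji] //= := eqVneq j i.
by move=> jA; exact: st.
Qed.

Lemma antitone_stable H : antitone H ->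
  exists T, forall t, H t = H (truncate T t).
Proof.
move=> aH; have [T HT] := antitone_slice_stable [set: J] (fun=> 0%N) aH.
exists T => t; apply/eqP; rewrite eqn_leq HT ?andbT.
  by apply: aH => j; exact: geq_minl.
by move=> j; rewrite inE.
Qed.

(** Such a map is determined by a truncation level and finitely many values. *)
Lemma countable_antitone : countable [set H | antitone H].
Proof.
pose stable T H := forall t, H t = H (truncate T t).
have -> : [set H | antitone H] =
    \bigcup_(T in setT) [set H | antitone H /\ stable T H].
  apply/seteqP; split=> [H aH|H [T _ []]//].
  by have [T HT] := antitone_stable aH; exists T.
apply: bigcup_countable => // T _; apply/countable_injP.
pose values H := [seq H (fun j => val (g j)) | g : {ffun J -> 'I_T.+1}].
exists (choice.pickle \o values) => H H' /set_mem[_ sH] /set_mem[_ sH'].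
move=> /(pcan_inj choice.pickleK) HH'; apply/funext => t.
rewrite sH sH'; pose g := [ffun j => inord (minn (t j) T) : 'I_T.+1].
have -> : truncate T t = (fun j => val (g j)).
  by apply/funext => j; rewrite ffunE /= inordK// ltnS geq_minr.
have gE : g \in enum {ffun J -> 'I_T.+1} by rewrite mem_enum.
exact: (eq_in_map _ _ _).2 HH' g gE.
Qed.

End antitone_maps.

(** One representative of each code gives a countable dense set. *)
Lemma metrically_separable_codes (R : realType) (T I : Type) (K : I -> Type)
    (S : set T) (dist : T -> T -> \bar R) (C : I -> set T)
    (code : forall i, T -> K i) :
  countable [set: I] ->
  (forall i, C i `<=` S) -> (forall i, countable (code i @` C i)) ->
  (forall x e, S x -> 0 < e -> exists2 i, C i x &
    forall y, C i y -> code i y = code i x -> (dist x y < e%:E)%E) ->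
  metrically_separable S dist.
Proof.
move=> cI CS cK near_code.
have /choice[rep repP] : forall ik : {i : I & K i}, exists y : option T,
    forall x, C (tag ik) x -> code (tag ik) x = tagged ik ->
    exists2 z, y = Some z & C (tag ik) z /\ code (tag ik) z = tagged ik.
  move=> [i k] /=; have [[y yP]|no] := pselect (exists y, C i y /\ code i y = k).
    by exists (Some y) => x _ _; exists y.
  by exists None => x Cx kx; exfalso; apply: no; exists x.
pose D i := [set y | C i y /\ rep (Tagged K (code i y)) = Some y].
exists (\bigcup_i D i).
  apply: bigcup_countable => // i _.
  have inj : {in D i &, injective (code i)}.
    move=> y z /set_mem[_ yP] /set_mem[_ zP] yz.
    by move: yP; rewrite yz zP => -[].
  rewrite -(eq_countable (inj_card_eq inj)).
  apply: (sub_countable _ (cK i)); apply/subset_card_le/image_subset.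
  by move=> y [].
split=> [y [i _ [Cy _]]|x Sx e e0]; first exact: CS Cy.
have [i Cx xP] := near_code x e Sx e0.
have /= [y yP [Cy cy]] := repP (Tagged K (code i x)) x Cx erefl.
exists y; last exact: xP.
by exists i => //; split=> //; rewrite cy.
Qed.

(** * Types as Lipschitz functions *)

Section seminorm_combinations.
Variables (R : realType) (V : lmodType R) (p : V -> R).
Hypothesis sp : seminorm p.

Lemma seminorm0 : p 0 = 0.
Proof. exact: sublinear0 (seminorm_sublinear sp). Qed.

Lemma seminormN x : p (- x) = p x.
Proof. by have [_ _ pZ] := sp; rewrite -scaleN1r pZ normrN1 mul1r. Qed.

Lemma seminorm_sum (I : finType) (G : I -> V) : p (\sum_i G i) <= \sum_i p (G i).
Proof.
have [_ pD _] := sp.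
apply: (big_ind2 (fun x a => p x <= a)) => [|x a y b xa yb|//].
  by rewrite seminorm0.
exact: le_trans (pD x y) (lerD xa yb).
Qed.

Lemma seminorm_dist x y : `|p x - p y| <= p (x - y).
Proof.
have [_ pD _] := sp; rewrite ler_norml; apply/andP; split.
  have := pD (y - x) x; rewrite subrK -opprB seminormN; lra.
have := pD (x - y) y; rewrite subrK; lra.
Qed.

Lemma seminorm_comb (J : finType) (w : J -> V) (c s t : J -> R) :
  (forall j, p (w j) <= c j) -> (forall j, s j <= t j) ->
  `|p (\sum_j t j *: w j) - p (\sum_j s j *: w j)| <=
    \sum_j t j * c j - \sum_j s j * c j.
Proof.
have [_ _ pZ] := sp; move=> wc st; apply: le_trans (seminorm_dist _ _) _.
rewrite -!sumrB; apply: le_trans (seminorm_sum _) _; apply: ler_sum => j _.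
by rewrite -mulrBl -scalerBl pZ ger0_norm ?subr_ge0// ler_wpM2l// subr_ge0.
Qed.

End seminorm_combinations.

Section type_bounds.
Variables (R : realType) (E : completeNormedModType R) (n : nat).
Implicit Types (xi zeta : formal_ext E n -> R) (u : formal_ext E n).

Lemma type_var_le xi (M : R) l : seminorm xi ->
  (forall i, xi (0, delta_mx 0 i) <= M) -> xi (0, l) <= M * l1norm l.
Proof.
move=> sxi xiM; have [_ _ xiZ] := sxi.
have -> : (0, l) = \sum_(i < n) l 0 i *: ((0, delta_mx 0 i) : formal_ext E n).
  rewrite [RHS]surjective_pairing !raddf_sum/=; congr (_, _).
    by rewrite big1// => i _; exact: scaler0.
  exact: row_sum_delta.
apply: le_trans (seminorm_sum sxi _) _; rewrite mulr_sumr ler_sum// => i _.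
by rewrite xiZ mulrC ler_wpM2r.
Qed.

Lemma type_lipschitz xi (M : R) b b' l l' : ntypes xi ->
  (forall i, xi (0, delta_mx 0 i) <= M) ->
  `|xi (b, l) - xi (b', l')| <= `|b - b'| + M * l1norm (l - l').
Proof.
move=> [sxi xiE] xiM; have [_ xiD _] := sxi.
apply: le_trans (seminorm_dist sxi _ _) _.
have := xiD (b - b', 0) (0, l - l').
have -> : (b - b', 0) + (0, l - l') = (b, l) - (b', l') :> formal_ext E n.
  by congr (_, _); rewrite /= ?addr0 ?add0r.
by move=> /le_trans; apply; rewrite xiE lerD2l type_var_le.
Qed.

Lemma type_dist_le_sphere xi zeta (r : R) : ntypes xi -> ntypes zeta -> 0 <= r ->
  (forall b l, l1norm l = 1 -> `|xi (b, l) - zeta (b, l)| <= r) ->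
  (type_dist xi zeta <= r%:E)%E.
Proof.
move=> txi tzeta r0 H; apply: type_dist_le => // -[b l] /=.
have [[_ _ xiZ] xiE] := txi; have [[_ _ zetaZ] zetaE] := tzeta.
have := l1norm_ge0 l; rewrite le_eqVlt => /predU1P[l0|l0].
  have -> : l = 0.
    apply/rowP => i; rewrite mxE; apply/eqP; rewrite -normr_eq0.
    by rewrite (psumr_eq0P _ (esym l0)).
  by rewrite xiE zetaE subrr normr0 mulr_ge0// l1norm_ge0.
have lZ : l1norm ((l1norm l)^-1 *: l) = 1.
  by rewrite l1normZ ger0_norm ?invr_ge0 ?ltW// mulVf// gt_eqF.
have -> : (b, l) = l1norm l *: ((l1norm l)^-1 *: b, (l1norm l)^-1 *: l) :> formal_ext E n.
  by congr (_, _); rewrite /= scalerA divff ?gt_eqF// scale1r.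
rewrite xiZ zetaZ -mulrBr normrM normr_id [X in X * _]ger0_norm ?l1norm_ge0//.
rewrite [leRHS]mulrC.
by rewrite ler_wpM2l ?l1norm_ge0 ?H.
Qed.

End type_bounds.

(** * Separability over a polyhedral space *)

Section polyhedral_types.
Variables (R : realType) (E : completeNormedModType R) (n m : nat).
Variable v : 'I_m -> E.
Hypothesis ball_hull : [set x : E | `|x| <= 1] = convex_hull v.
Implicit Types (xi zeta : formal_ext E n -> R) (M : R) (k : nat).

Let J : finType := ('I_m + ('I_n + 'I_n))%type.

(** When the unit ball is the hull of the [v i], every element of [E(n)] is a
    nonnegative combination of these vectors in which the total coefficient of
    the [v i] is the norm of the component in [E]. *)
Definition cone_vector (j : J) : formal_ext E n :=
  match j with
  | inl i => (v i, 0)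
  | inr (inl i) => (0, delta_mx 0 i)
  | inr (inr i) => (0, - delta_mx 0 i)
  end.

Definition cone_weight M (j : J) : R := if j is inl _ then 1 else M.

Definition cone_point (s : J -> R) := \sum_j s j *: cone_vector j.
Definition cone_length M (s : J -> R) := \sum_j s j * cone_weight M j.

Definition bounded_types M : set (formal_ext E n -> R) :=
  [set xi | ntypes xi /\ forall i, xi (0, delta_mx 0 i) <= M].

Lemma cone_vector_le xi M j : bounded_types M xi ->
  xi (cone_vector j) <= cone_weight M j.
Proof.
move=> [[sxi xiE] xiM]; case: j => [i|[i|i]] /=; rewrite ?xiM//.
  rewrite xiE; suff : [set x : E | `|x| <= 1] (v i) by [].
  rewrite ball_hull; exists (fun j => (j == i)%:R); split=> [j||].
  - exact: ler0n.
  - rewrite (bigD1 i)//= eqxx big1 ?addr0// => j /negbTE ->.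
    by [].
  - rewrite (bigD1 i)//= eqxx scale1r big1 ?addr0// => j /negbTE ->.
    by rewrite scale0r.
have -> : (0, - delta_mx 0 i) = - (0, delta_mx 0 i) :> formal_ext E n.
  by congr (_, _); rewrite /= oppr0.
by rewrite seminormN.
Qed.

Lemma cone_point_decomposition M b l : exists s : J -> R,
  [/\ forall j, 0 <= s j, cone_point s = (b, l) &
      cone_length M s = `|b| + M * l1norm l].
Proof.
have [c [c0 c1 bc]] : exists c : 'I_m -> R, [/\ forall i, 0 <= c i,
    \sum_i c i = `|b| & b = \sum_i c i *: v i].
  have [->|b0] := eqVneq b 0.
    exists (fun=> 0); split=> //; first by rewrite big1// normr0.
    by rewrite big1// => i _; rewrite scale0r.
  have nb : 0 < `|b| by rewrite normr_gt0.
  have : [set x : E | `|x| <= 1] (`|b|^-1 *: b).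
    by rewrite /= normrZ normfV normr_id mulVf// gt_eqF.
  rewrite ball_hull => -[c [c0 c1 bc]]; exists (fun i => `|b| * c i); split.
  - by move=> i; rewrite mulr_ge0.
  - by rewrite -mulr_sumr c1 mulr1.
  - under eq_bigr do rewrite -scalerA.
    by rewrite -scaler_sumr -bc scalerA divff ?gt_eqF// scale1r.
pose s (j : J) := match j with
  | inl i => c i
  | inr (inl i) => Num.max 0 (l 0 i)
  | inr (inr i) => Num.max 0 (- l 0 i) end.
have sumJ (T : nmodType) (G : J -> T) : \sum_j G j =
    \sum_i G (inl i) + \sum_i (G (inr (inl i)) + G (inr (inr i))).
  by rewrite !big_sumType/= big_split.
have posneg (x : R) :
    Num.max 0 x - Num.max 0 (- x) = x /\ Num.max 0 x + Num.max 0 (- x) = `|x|.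
  have [x0|/ltW x0] := lerP 0 x.
    by rewrite max_l ?oppr_le0// subr0 addr0 ger0_norm.
  by rewrite max_r ?oppr_ge0// sub0r add0r opprK ler0_norm.
exists s; split.
- by move=> [i|[i|i]] //=; rewrite le_max lexx.
- rewrite /cone_point sumJ/= [LHS]surjective_pairing; congr (_, _) => /=.
    rewrite !raddf_sum/= [X in _ + X]big1 ?addr0 ?bc// => i _.
    by rewrite !scaler0 addr0.
  rewrite !raddf_sum/= big1 ?add0r; last by move=> i _; rewrite scaler0.
  rewrite [RHS]row_sum_delta; apply: eq_bigr => i _.
  rewrite scalerN -scalerBl; congr (_ *: _).
  by have [? ?] := posneg (l 0 i).
- rewrite /cone_length sumJ/=; congr (_ + _).
    by rewrite -c1; apply: eq_bigr => i _; rewrite mulr1.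
  rewrite mulr_sumr; apply: eq_bigr => i _; rewrite -mulrDl mulrC; congr (_ * _).
  by have [] := posneg (l 0 i).
Qed.

(** In the coordinates of the cone, subtracting the length from a type makes it
    non-increasing in each coordinate.  Adding twice the bound [M] on the
    variables makes it nonnegative at the points of interest, so truncation to a
    natural number, in units of the mesh of the grid, loses little there. *)
Definition type_code (kM : nat * nat) xi (t : J -> nat) : nat :=
  let s j := (t j)%:R / kM.1.+1%:R in
  Num.truncn ((xi (cone_point s) - cone_length kM.2%:R s + kM.2%:R *+ 2)
              * kM.1.+1%:R).

Lemma type_code_antitone kM xi : bounded_types kM.2%:R xi ->
  antitone (type_code kM xi).
Proof.
move=> xiM s t st; apply: le_truncn; rewrite ler_wpM2r// lerD2r.
have [[[sxi _] _]] := (xiM, tt).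
have := seminorm_comb sxi (fun j => cone_vector_le j xiM)
  (s := fun j => (s j)%:R / kM.1.+1%:R) (t := fun j => (t j)%:R / kM.1.+1%:R).
have st' j : (s j)%:R / kM.1.+1%:R <= (t j)%:R / kM.1.+1%:R :> R.
  by rewrite ler_wpM2r// ler_nat.
move=> /(_ st'); rewrite ler_norml => /andP[_].
by move=> h; rewrite lerBlDr addrC addrA addrAC -lerBlDr.
Qed.

(** The coordinates of [(b, l)] are rounded down to the grid.  This moves each
    type by at most the total weight times the mesh, and at the rounded point
    the quantity truncated by the code is nonnegative, because the length of the
    chosen decomposition is [`|b| + M] and types are at least [`|b| - M]. *)
Lemma type_code_close kM xi zeta b l :
  bounded_types kM.2%:R xi -> bounded_types kM.2%:R zeta ->
  type_code kM xi = type_code kM zeta -> l1norm l = 1 ->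
  `|xi (b, l) - zeta (b, l)| <=
    (1 + 2 * \sum_j cone_weight kM.2%:R j) / kM.1.+1%:R.
Proof.
case: kM => k M /= xiM zetaM same l1; set K : R := k.+1%:R.
have K0 : 0 < K by rewrite ltr0n.
have [s [s0 sbl slen]] := cone_point_decomposition M%:R b l.
pose t j := Num.truncn (s j * K); pose t' j : R := (t j)%:R / K.
have t's j : t' j <= s j.
  by rewrite /t' ler_pdivrMr// truncn_le mulr_ge0// ltW.
have st' j : s j - t' j <= K^-1.
  rewrite lerBlDl /t' -[X in _ + X]mul1r -mulrDl ler_pdivlMr//.
  by rewrite natr1 ltW // truncnS_gt.
have weight0 j : 0 <= cone_weight M%:R j by case: j => [i|i] //=; rewrite ler01.
have step z : bounded_types M%:R z ->
    `|z (b, l) - z (cone_point t')| <= cone_length M%:R s - cone_length M%:R t'.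
  move=> zM; have [[sz _] _] := zM; rewrite -sbl.
  exact: (seminorm_comb sz (fun j => cone_vector_le j zM) t's).
have gap : cone_length M%:R s - cone_length M%:R t' <=
    (\sum_j cone_weight M%:R j) / K.
  rewrite -sumrB mulr_suml ler_sum// => j _.
  by rewrite -mulrBl mulrC ler_wpM2l.
have ge0 z : bounded_types M%:R z ->
    0 <= z (cone_point t') - cone_length M%:R t' + M%:R *+ 2.
  move=> zM; have := step z zM; rewrite ler_norml => /andP[_].
  have [tz zM'] := zM; have := type_lipschitz b b l 0 tz zM'.
  rewrite subrr normr0 add0r subr0 l1 mulr1 tz.2 ler_norml => /andP[].
  by rewrite slen l1; lra.
have : `|xi (cone_point t') - zeta (cone_point t')| <= K^-1.
  have := congr1 (fun f => f t) same; rewrite /type_code/= -/K.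
  rewrite -/t'; set a := _ * K; set c := _ * K => ac.
  have a0 : 0 <= a by rewrite mulr_ge0 ?ge0// ltW.
  have c0 : 0 <= c by rewrite mulr_ge0 ?ge0// ltW.
  have /andP[a1 a2] := truncn_itv a0; have /andP[c1 c2] := truncn_itv c0.
  rewrite -ac -natr1 in c1 c2; rewrite -natr1 in a2.
  have : `|a - c| <= 1 by rewrite ler_norml; lra.
  rewrite -mulrBl normrM (gtr0_norm K0) -ler_pdivlMr// div1r.
  have cancel x y z w : x - z + w - (y - z + w) = x - y :> R by ring.
  by rewrite cancel.
have := step xi xiM; have := step zeta zetaM.
rewrite mulrDl div1r -mulrA; set L := cone_length _ _ - _ in gap *.
set S := _ / K in gap *; move: (xi (b, l)) (zeta (b, l)) (xi _) (zeta _) => x y x' y'.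
move: K^-1 L S gap => e L S gap.
rewrite !ler_norml => /andP[? ?] /andP[? ?] /andP[? ?]; apply/andP; split; lra.
Qed.

Lemma types_metrically_separable :
  metrically_separable (@ntypes R E n) (@type_dist R E n).
Proof.
apply: (@metrically_separable_codes _ _ _ (fun=> (J -> nat) -> nat) _ _
  (fun kM : nat * nat => bounded_types kM.2%:R) type_code) => [|kM xi []//|kM|].
- exact: countableP.
- apply: sub_countable (countable_antitone J); apply: subset_card_le.
  by move=> _ [xi xiM <-]; exact: type_code_antitone.
- move=> xi e txi e0.
  pose M := Num.truncn (\sum_i xi (0, delta_mx 0 i)).
  have xiM : bounded_types M.+1%:R xi.
    split=> // i; rewrite (le_trans _ (ltW (truncnS_gt _)))//.
    by rewrite (bigD1 i)//= lerDl sumr_ge0// => j _; have [[]] := txi.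
  pose B : R := 1 + 2 * \sum_j cone_weight M.+1%:R j.
  have B0 : 0 <= B.
    by rewrite addr_ge0// mulr_ge0// sumr_ge0// => -[i|i] _ /=.
  pose k := Num.truncn (B / e).
  have ke : B / k.+1%:R < e.
    by rewrite ltr_pdivrMr// mulrC -ltr_pdivrMr// truncnS_gt.
  exists (k, M.+1) => // zeta zetaM same.
  apply: le_lt_trans (_ : (_ <= (B / k.+1%:R)%:E)%E) _; last by rewrite lte_fin.
  apply: type_dist_le_sphere => //; first exact: zetaM.1.
    by rewrite divr_ge0.
  move=> b l l1; exact: (@type_code_close (k, M.+1)).
Qed.

End polyhedral_types.

(** * Spaces normed by finitely many functionals *)

Section finitely_many_norming_functionals.
Variables (R : realType) (E : normedModType R) (k : nat) (f : 'I_k -> E -> R).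
Hypothesis f_below : forall i, linear_below (fun x : E => `|x|) (f i).
Hypothesis f_norming : forall x, exists i, f i x = `|x|.
Implicit Types (x y z : E) (I : {set 'I_k}).

Definition active x : {set 'I_k} := [set i | f i x == 1].

Definition is_vertex I x :=
  [/\ `|x| <= 1, (forall i, i \in I -> f i x = 1) &
      (forall y, (forall i, i \in I -> f i y = 0) -> y = 0)].

Lemma vertex_uniq I x y : is_vertex I x -> is_vertex I y -> x = y.
Proof.
move=> [_ xI kI] [_ yI _]; apply/eqP; rewrite -subr_eq0; apply/eqP/kI => i iI.
by rewrite (linear_belowB (f_below i)) xI// yI// subrr.
Qed.

(** The vertices are indexed by sets of constraints, with [0], a point
    of the ball, for the sets that determine no vertex. *)
Lemma vertices_exist : exists v : {set 'I_k} -> E,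
  forall I, `|v I| <= 1 /\ forall x, is_vertex I x -> x = v I.
Proof.
suff /choice[v vP] : forall I, exists w, `|w| <= 1 /\ forall x, is_vertex I x -> x = w.
  by exists v.
move=> I; have [[x vx]|no] := pselect (exists x, is_vertex I x).
  by exists x; split=> [|y vy]; [case: vx|exact: vertex_uniq vx].
by exists 0; rewrite normr0; split=> // x vx; exfalso; apply: no; exists x.
Qed.

(** Moving from a point of the ball along a direction that keeps the active
    constraints, one leaves the ball through a new constraint. *)
Lemma exit_point x y : `|x| <= 1 -> y != 0 ->
  (forall i, i \in active x -> f i y = 0) ->
  exists t, [/\ 0 < t, `|x + t *: y| <= 1 & active x \proper active (x + t *: y)].
Proof.
move=> x1 y0 yI; have [i1 fi1] := f_norming y.
have {}fi1 : 0 < f i1 y by rewrite fi1 normr_gt0.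
have fx i : f i x <= 1 by apply: le_trans ((f_below i).2 x) x1.
have fxy i t : f i (x + t *: y) = f i x + t * f i y.
  by rewrite (linear_belowD (f_below i)) (linear_belowZ (f_below i)).
pose g i := (1 - f i x) / f i y.
case: (@Order.TotalTheory.arg_minP _ _ _ i1 (fun i => 0 < f i y) g fi1) => i0 fi0 imin.
have i0I : i0 \notin active x.
  by apply/negP => /yI fi00; rewrite fi00 ltxx in fi0.
have g0 : 0 < g i0.
  by rewrite divr_gt0// subr_gt0 lt_neqAle fx andbT; move: i0I; rewrite inE.
exists (g i0); split=> //.
  have [i <-] := f_norming (x + g i0 *: y); rewrite fxy.
  have [fi|fi] := ltP 0 (f i y); last first.
    by rewrite (le_trans _ (fx i))// gerDl mulr_ge0_le0// ltW.
  by rewrite -lerBrDl -ler_pdivlMr// imin.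
apply/properP; split; last first.
  by exists i0 => //; rewrite inE fxy /g divfK ?(gt_eqF fi0)// addrC subrK eqxx.
apply/fintype.subsetP => i iI; rewrite inE fxy yI// mulr0 addr0.
by move: iI; rewrite inE.
Qed.

Lemma polytope_of_finType (T : finType) (v : T -> E) (A : set E) :
  (forall x, A x <-> exists c : T -> R,
    [/\ forall i, 0 <= c i, \sum_i c i = 1 & x = \sum_i c i *: v i]) ->
  polytope A.
Proof.
move=> AP; exists #|T|, (v \o enum_val); apply/seteqP; split=> x.
  move=> /AP[c [c0 c1 ->]]; exists (c \o enum_val); split=> [i||] //=.
    by rewrite -c1 (reindex _ (onW_bij _ (enum_val_bij T))).
  by rewrite (reindex _ (onW_bij _ (enum_val_bij T))).
move=> [c [c0 c1 ->]]; apply/AP; exists (c \o enum_rank); split=> [i||] //=.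
  by rewrite -c1 (reindex _ (onW_bij _ (enum_rank_bij T))).
rewrite (reindex _ (onW_bij _ (enum_rank_bij T))); apply: eq_bigr => i _ /=.
by rewrite enum_rankK.
Qed.

(** Induction on the number of inactive constraints: if some direction keeps the
    active ones, the point lies between two exit points with more active
    constraints; otherwise the active constraints determine it. *)
Lemma ball_is_hull (v : {set 'I_k} -> E) :
  (forall I, `|v I| <= 1 /\ forall x, is_vertex I x -> x = v I) ->
  forall x, `|x| <= 1 <-> exists c : {set 'I_k} -> R,
    [/\ forall I, 0 <= c I, \sum_I c I = 1 & x = \sum_I c I *: v I].
Proof.
move=> vP x; split; last first.
  move=> [c [c0 c1 ->]]; apply: le_trans (ler_norm_sum _ _ _) _.
  rewrite -c1 ler_sum// => I _; rewrite normrZ ger0_norm// ler_piMr//.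
  by have [] := vP I.
have [m] := ubnP (k - #|active x|)%N; elim: m => // m IH in x *.
rewrite ltnS => xm x1.
have [[y [y0 yI]]|no] := pselect (exists y, y != 0 /\
    forall i, i \in active x -> f i y = 0); last first.
  exists (fun I => (I == active x)%:R); split=> [I||].
  - exact: ler0n.
  - by rewrite (bigD1 (active x))//= eqxx big1 ?addr0// => j /negbTE ->.
  - rewrite (bigD1 (active x))//= eqxx scale1r big1 ?addr0; last first.
      by move=> j /negbTE ->; rewrite scale0r.
    apply: (vP _).2; split=> // [i|y yI]; first by rewrite inE => /eqP.
    by apply/eqP/negPn/negP => y0; apply: no; exists y.
have smaller z : active x \proper active z -> (k - #|active z| < m)%N.
  move=> /proper_card xz; apply: leq_trans xm; rewrite ltn_sub2l//.
  by apply: leq_trans xz _; rewrite -[leqRHS]card_ord max_card.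
have [t [t0 xt1 /smaller/IH/(_ xt1)[c [c0 c1 xtE]]]] := exit_point x1 y0 yI.
have [||s [s0 xs1 /smaller/IH/(_ xs1)[d [d0 d1 xsE]]]] := @exit_point x (- y) x1.
- by rewrite oppr_eq0.
- by move=> i /yI yi; rewrite (linear_belowN (f_below i)) yi oppr0.
have st0 : s + t != 0 by rewrite gt_eqF// addr_gt0.
pose a := s / (s + t); pose b := t / (s + t).
have a0 : 0 <= a by rewrite divr_ge0 ?addr_ge0 ?ltW.
have b0 : 0 <= b by rewrite divr_ge0 ?addr_ge0 ?ltW.
have ab : a + b = 1 by rewrite -mulrDl divff.
have atbs : a * t = b * s by rewrite /a /b; ring.
exists (fun I => a * c I + b * d I); split.
- by move=> I; apply: addr_ge0; exact: mulr_ge0.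
- by rewrite big_split/= -!mulr_sumr c1 d1 !mulr1.
under eq_bigr do rewrite scalerDl -!scalerA.
rewrite big_split/= -!scaler_sumr -xtE -xsE !scalerDr !scalerA scalerN addrACA.
by rewrite -scalerDl -scalerBl ab atbs subrr scale1r scale0r addr0.
Qed.

Lemma finitely_many_norming_polyhedral : finite_dimensional E /\ polyhedral E.
Proof.
have [v vP] := vertices_exist; have hull := ball_is_hull vP.
have pE : polyhedral E by apply: polytope_of_finType hull.
split=> //; have [m [w ballE]] := pE; exists m, w => x.
have [->|x0] := eqVneq x 0.
  by exists (fun=> 0); rewrite big1// => i _; rewrite scale0r.
have : [set x : E | `|x| <= 1] (`|x|^-1 *: x).
  by rewrite /= normrZ normfV normr_id mulVf// normr_eq0.
rewrite ballE => -[c [_ _ xE]]; exists (fun i => `|x| * c i).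
under eq_bigr do rewrite -scalerA.
by rewrite -scaler_sumr -xE scalerA divff ?normr_eq0// scale1r.
Qed.

End finitely_many_norming_functionals.

(** * Smooth points *)

Section smooth_points.
Variables (R : realType) (E : completeNormedModType R).
Implicit Types (x y : E) (f g : E -> R).

Definition contractive f := linear_below (fun x : E => `|x|) f.

Lemma norm_seminorm : seminorm (fun x : E => `|x|).
Proof. by split=> [//||t x]; [exact: ler_normD|exact: normrZ]. Qed.

Lemma contractive_dist f x y : contractive f -> `|f x - f y| <= `|x - y|.
Proof.
move=> cf; rewrite -(linear_belowB cf).
exact: linear_below_norm cf _ norm_seminorm.
Qed.

Lemma norming_exists x : exists2 f, contractive f & f x = `|x|.
Proof. exact: hahn_banach x (seminorm_sublinear norm_seminorm). Qed.

Definition smooth x := forall f g, contractive f -> contractive g ->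
  f x = `|x| -> g x = `|x| -> f = g.

(** Differentiability of the norm in the direction [y], up to [1 / k.+1]. *)
Definition flat y (k : nat) : set E :=
  [set x | exists2 t : R, 0 < t &
    `|x + t *: y| + `|x - t *: y| - `|x| *+ 2 < t / k.+1%:R].

Lemma flat_open y k : open (flat y k).
Proof.
pose D t x : R := t / k.+1%:R - (`|x + t *: y| + `|x - t *: y| - `|x| *+ 2).
have -> : flat y k = \bigcup_(t in [set t | 0 < t]) (D t @^-1` [set r | 0 < r]).
  apply/seteqP; split=> x [t t0] xt; exists t => //; move: xt;
    by rewrite /D /= subr_gt0.
apply: bigcup_open => t _; apply: open_comp; last exact: open_gt.
move=> x _; apply: cvgB; first exact: cvg_cst.
apply: cvgB; last by apply: cvgMn; apply: cvg_norm; exact: cvg_id.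
apply: cvgD; apply: cvg_norm.
  by apply: cvgD; [exact: cvg_id|exact: cvg_cst].
by apply: cvgB; [exact: cvg_id|exact: cvg_cst].
Qed.

(** Along an arithmetic progression the second differences of the norm add up
    to a difference of two slopes, so they cannot all be large. *)
Lemma flat_dense y k : dense (flat y k).
Proof.
move=> O [x0 Ox0] oO.
have /nbhs_ballP[r /= r0 rO] := open_nbhs_nbhs (conj oO Ox0).
pose N := (Num.truncn (2 * `|y| * k.+1%:R)).+1.
have N0 : 0 < N.+1%:R * (`|y| + 1) :> R by rewrite mulr_gt0// ltr_wpDl.
pose h := r / (N.+1%:R * (`|y| + 1)).
have h0 : 0 < h by rewrite divr_gt0.
have hr : N.+1%:R * h * (`|y| + 1) = r.
  by rewrite mulrAC mulrC divfK// gt_eqF.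
pose z (i : nat) := x0 + (i%:R * h) *: y.
have zO i : (i <= N)%N -> O (z i).
  move=> iN; apply: rO; rewrite -ball_normE/= opprD addrA subrr sub0r normrN.
  rewrite normrZ ger0_norm -?hr; last by rewrite mulr_ge0// ltW.
  apply: (@le_lt_trans _ _ (N.+1%:R * h * `|y|)).
    by rewrite ler_wpM2r// ler_wpM2r ?(ltW h0)// ler_nat leqW.
  by rewrite ltr_pM2l ?mulr_gt0// ltrDl.
have [[j jN xj]|no] := pselect (exists2 i, (i < N)%N & flat y k (z i.+1)).
  by exists (z j.+1); split=> //; exact: zO.
exfalso.
have step i : (i < N)%N ->
    h / k.+1%:R <= (`|z i.+2| - `|z i.+1|) - (`|z i.+1| - `|z i|).
  move=> iN; rewrite leNgt; apply/negP => lt; apply: no; exists i => //.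
  exists h => //; apply: le_lt_trans lt.
  have -> : z i.+1 + h *: y = z i.+2.
    by rewrite /z -addrA -scalerDl -[in RHS]natr1 mulrDl mul1r.
  have -> : z i.+1 - h *: y = z i.
    by rewrite /z -addrA -scalerBl -natr1 mulrDl mul1r addrK.
  by rewrite mulr2n; lra.
have sum M : (M <= N)%N -> M%:R * (h / k.+1%:R) <=
    (`|z M.+1| - `|z M|) - (`|z 1%N| - `|z 0%N|).
  elim: M => [|M IH] MN; first by rewrite mul0r subrr.
  have := IH (ltnW MN); have := step M MN; rewrite -[M.+1%:R]natr1 mulrDl mul1r.
  move: (h / _) => q; move: (M%:R * q) => a; lra.
have dz i : `| `|z i.+1| - `|z i| | <= h * `|y|.
  apply: le_trans (ler_dist_dist _ _) _.
  rewrite /z opprD addrACA subrr add0r -scalerBl -natr1 mulrDl mul1r addrAC subrr.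
  by rewrite add0r normrZ gtr0_norm.
have : N%:R * (h / k.+1%:R) <= 2 * (h * `|y|).
  have := sum N (leqnn N); have := dz N; have := dz 0%N.
  move: (N%:R * _) (h * _) => a b; rewrite !ler_norml => /andP[? ?] /andP[? ?] ?; lra.
rewrite leNgt mulrCA [ltRHS]mulrCA ltr_pM2l// ltr_pdivlMr// => /negP; apply.
by rewrite truncnS_gt.
Qed.

(** Mazur's theorem, by Baire category over a dense sequence of directions: at a
    point that is flat in a direction, two norming functionals almost agree on
    that direction. *)
Lemma smooth_dense : separable_space E -> dense smooth.
Proof.
move=> [D cD dD].
have [y yD] : exists y : nat -> E, D `<=` range y.
  have /countable_injP[g ginj] := cD.
  have /choice[y yP] : forall i, exists x, forall z, D z -> g z = i -> z = x.
    move=> i; have [[x [Dx gx]]|no] := pselect (exists x, D x /\ g x = i).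
      by exists x => z Dz gz; apply: ginj; rewrite ?inE ?gx.
    by exists 0 => z Dz gz; exfalso; apply: no; exists z.
  by exists y => z Dz; exists (g z) => //; rewrite -(yP _ z).
pose F (i : nat) := let p := odflt (0, 0)%N (choice.unpickle i) in flat (y p.1) p.2.
have /Baire denseF i : open (F i) /\ dense (F i).
  by split; [exact: flat_open|exact: flat_dense].
move=> O O0 oO; have [x [Ox Fx]] := denseF O O0 oO; exists x; split=> //.
have key f g : contractive f -> contractive g -> f x = `|x| -> g x = `|x| ->
    forall z, f z <= g z.
  move=> cf cg fx gx.
  have yle i : f (y i) <= g (y i).
    apply/ler_addgt0Pr => e e0; pose k := Num.truncn e^-1.
    have [t t0] : flat (y i) k x.
      by have := Fx (choice.pickle (i, k)) I; rewrite /F choice.pickleK.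
    rewrite -lerBlDl.
    have ke : k.+1%:R^-1 < e by rewrite invf_plt ?posrE// truncnS_gt.
    have := cf.2 (x + t *: y i); have := cg.2 (x - t *: y i).
    rewrite (linear_belowD cf) (linear_belowB cg) (linear_belowZ cf)
      (linear_belowZ cg) fx gx => h1 h2 h3.
    rewrite ltW// (lt_trans _ ke)// -(ltr_pM2l t0) mulrBr; move: h3 h2 h1; rewrite mulr2n.
    move: (t * f _) (t * g _) (t / _) `|_| `|_| `|_| => a b c u v w. lra.
  move=> z; apply/ler_addgt0Pr => e e0.
  have [w [wz Dw]] : ball z (e / 2) `&` D !=set0.
    apply: dD; last exact: ball_open.
    by exists z; apply: ballxx; rewrite divr_gt0.
  have [i _ yw] := yD w Dw; have := yle i; rewrite yw.
  move: wz; rewrite -ball_normE/= => wz.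
  have := contractive_dist z w cf; have := contractive_dist z w cg.
  rewrite !ler_norml => /andP[? ?] /andP[? ?]; lra.
by move=> f g cf cg fx gx; apply/funext => z; apply/le_anti; rewrite !key.
Qed.

End smooth_points.

(** * A separated sequence of functionals *)

Section separated_functionals.
Variables (R : realType) (E : completeNormedModType R).
Implicit Types (x y : E) (f g : E -> R).

Lemma contractive_continuous f : contractive f -> continuous f.
Proof.
move=> cf x; apply/cvgrPdist_lt => e e0; near=> z.
apply: le_lt_trans (contractive_dist x z cf) _.
by near: z; exact: (@cvgr_dist_lt _ _ _ (nbhs x) _ id x).
Unshelve. all: by end_near. Qed.

Definition smooth_norming : set (E -> R) :=
  [set f | contractive f /\ exists2 x, smooth x & f x = `|x|].

(** The points where none of finitely many functionals attains the norm form an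
    open set.  If it is not empty it contains a smooth point, whose norming
    functional is then a new one. *)
Lemma finite_smooth_norming_polyhedral : separable_space E ->
  finite_set smooth_norming -> finite_dimensional E /\ polyhedral E.
Proof.
move=> sepE /finite_seqP[s sE].
pose g (i : 'I_(size s)) := tnth (in_tuple s) i.
have gs i : smooth_norming (g i) by rewrite sE /=; exact: mem_tnth.
apply: (@finitely_many_norming_polyhedral _ _ _ g) => [i|x].
  by have [] := gs i.
apply: contrapT => no; have lt i z : g i z <= `|z| by have [[_ + ] _] := gs i.
pose U : set E := [set z | forall i, g i z < `|z|].
have oU : open U.
  rewrite openE => z Uz; apply: filter_forall => i.
  pose D w := `|w| - g i w.
  apply: (@filterS _ (nbhs z) _ (D @^-1` [set r | 0 < r])).
    by move=> w; rewrite /D /= subr_gt0.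
  apply: open_nbhs_nbhs; split; last by rewrite /D /= subr_gt0.
  apply: open_comp; last exact: open_gt.
  move=> w _; apply: cvgB; first by apply: cvg_norm; exact: cvg_id.
  by apply: contractive_continuous; have [] := gs i.
have [|b [Ub sb]] := smooth_dense sepE _ oU.
  exists x => i; rewrite lt_neqAle lt andbT; apply/negP => /eqP gx.
  by apply: no; exists i.
have [f cf fb] := norming_exists b.
have : smooth_norming f by split=> //; exists b.
rewrite sE /= => /(@tnthP _ _ (in_tuple s))[i fi].
by have := Ub i; rewrite /g -fi fb ltxx.
Qed.

Lemma ultra_fmap (T T' : Type) (h : T -> T') (U : set_system T) :
  UltraFilter U -> UltraFilter (h @ U).
Proof.
move=> UU; split=> [|G PG UG]; first exact: fmap_proper_filter.
apply/seteqP; split=> // A GA; have [//|nA] := in_ultra_setVsetC (h @^-1` A) UU.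
by have [] := @filter_not_empty _ G PG; rewrite -(setICr A);
  apply: filterI => //; apply: UG.
Qed.

(** Weak-* compactness of the dual ball, through an ultrafilter. *)
Lemma contractive_ultralimit (U : set_system nat) (phi : nat -> E -> R) :
  UltraFilter U -> (forall k, contractive (phi k)) ->
  exists2 f, contractive f & forall y, (fun k => phi k y) @ U --> f y.
Proof.
move=> UU cphi.
have /choice[f fP] : forall y, exists r : R, r <= `|y| /\ (fun k => phi k y) @ U --> r.
  move=> y; have := @segment_compact R (- `|y|) `|y|; rewrite compact_ultra.
  move=> /(_ _ (ultra_fmap (fun k => phi k y) UU))[|r [ry cvr]].
    apply: (@filterE _ U) => k; rewrite /= in_itv/= -ler_norml.
    exact: linear_below_norm (cphi k) _ (@norm_seminorm _ _).
  by exists r; split=> //; move: ry; rewrite /= in_itv/= => /andP[].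
exists f => [|y]; last by have [] := fP y.
split=> [t x y|y]; last by have [] := fP y.
have [_ cxy] := fP (t *: x + y); apply: (cvg_unique _ cxy) => //.
have -> : (fun k => phi k (t *: x + y)) = (fun k => t * phi k x + phi k y).
  by apply/funext => k; rewrite (cphi k).1.
by apply: cvgD; [apply: cvgMr; have [] := fP x|have [] := fP y].
Qed.

(** A functional other than [phi k] cannot norm the smooth point [b k]; this
    applies to the other terms of the sequence and to the limit [f] along an
    ultrafilter, except for the single index [k0] where [f] may be a term.  A
    subsequence chosen so that its late terms are close to [f] at the earlier
    points then stays uniformly away from the norm at each [b k], and rescaling
    [b k] turns the gap into [1]. *)
Lemma separated_functionals : separable_space E ->
  ~ (finite_dimensional E /\ polyhedral E) ->
  exists (psi : nat -> E -> R) (c : nat -> E),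
    [/\ forall m, contractive (psi m), forall m, psi m (c m) = `|c m| &
        forall j m, j != m -> psi j (c m) <= `|c m| - 1].
Proof.
move=> sepE npoly.
have /infiniteP/pcard_leP/unsquash phi : infinite_set smooth_norming.
  by move=> /(finite_smooth_norming_polyhedral sepE).
have phiP k : smooth_norming (phi k) by exact: funS.
have phi_inj : injective phi by move=> i j; apply: inj; rewrite inE.
have cphi k : contractive (phi k) by have [] := phiP k.
have /choice[b bP] : forall k, exists x, smooth x /\ phi k x = `|x|.
  by move=> k; have [_ [x sx xE]] := phiP k; exists x.
have lt_other k f : contractive f -> f <> phi k -> f (b k) < `|b k|.
  move=> cf fk; rewrite lt_neqAle cf.2 andbT; apply/negP => /eqP fb.
  by apply: fk; have [sb bE] := bP k; exact: (sb _ _ cf (cphi k) fb bE).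
have [U [UU eventuallyU]] := ultraFilterLemma eventually_filter.
have [f cf phi_cvg] := contractive_ultralimit UU cphi.
have [N fN] : exists N, forall k, (N <= k)%N -> f (b k) < `|b k|.
  have [[k0 fk0]|no] := pselect (exists k, f = phi k).
    (* The terms up to [k0] are dropped. *)
    exists k0.+1 => k k0k; apply: lt_other => // fk.
    by move: k0k; rewrite (phi_inj k k0) ?ltnn// -fk.
  by exists 0%N => k _; apply: lt_other => // fk; apply: no; exists k.
pose half k := (`|b k| + f (b k)) / 2.
have /choice[next nextP] : forall k, exists j, (k < j)%N /\
    forall i, (N <= i <= k)%N -> phi j (b i) < half i.
  move=> k; apply: (@filter_ex _ U); apply: filterI.
    by apply: eventuallyU; exists k.+1.
  have : U (fun j => forall i : 'I_k.+1, (N <= i)%N -> phi j (b i) < half i).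
    apply: filter_forall => i; have [Ni|iN] := leqP N i; last first.
      by apply: (@filterE _ U).
    have fhalf : f (b i) < half i by have := fN i Ni; rewrite /half; lra.
    by apply: filterS (cvgr_lt _ (phi_cvg (b i)) _ fhalf) => j jlt _.
  by apply: filterS => j jP i /andP[Ni ik]; exact: (jP (Ordinal (ik : i < k.+1)%N)).
pose k m := iter m next N.
have kS m : k m.+1 = next (k m) by [].
have k_mono : {homo k : i j / (i < j)%N}.
  by apply: homo_ltn => [? ? ?|m]; [exact: ltn_trans|have [] := nextP (k m)].
have k_ge m : (N <= k m)%N.
  by elim: m => // m IH; rewrite kS (leq_trans IH)// ltnW//; have [] := nextP (k m).
have later j m : (m < j)%N -> phi (k j) (b (k m)) < half (k m).
  case: j => // j; rewrite ltnS leq_eqVlt kS => mj; have [_ ->//] := nextP (k j).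
  rewrite k_ge/=; case/predU1P: mj => [->//|mj]; exact: ltnW (k_mono _ _ mj).
have gap m : exists2 d, 0 < d & forall j, j != m ->
    phi (k j) (b (k m)) <= `|b (k m)| - d.
  pose g j := `|b (k m)| - phi (k j) (b (k m)).
  pose d := \big[Num.min/(`|b (k m)| - half (k m))]_(j < m) g j.
  exists d.
    apply: lt_bigmin => [|j _].
      by have := fN _ (k_ge m); rewrite /half; lra.
    rewrite subr_gt0; apply: lt_other => // /phi_inj kjm.
    by have := k_mono _ _ (ltn_ord j); rewrite kjm ltnn.
  move=> j; rewrite neq_ltn lerBrDl -lerBrDr => /orP[jm|mj].
    exact: (bigmin_le _ (Ordinal jm)).
  apply: (@le_trans _ _ (`|b (k m)| - half (k m))); first exact: bigmin_le_id.
  by rewrite lerB// ltW// later.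
have /choice[d dP] : forall m, exists d, 0 < d /\ forall j, j != m ->
    phi (k j) (b (k m)) <= `|b (k m)| - d.
  by move=> m; have [d] := gap m; exists d.
exists (fun m => phi (k m)), (fun m => (d m)^-1 *: b (k m)).
have nc m : `|(d m)^-1 *: b (k m)| = (d m)^-1 * `|b (k m)|.
  by have [d0 _] := dP m; rewrite normrZ gtr0_norm ?invr_gt0.
split=> [m|m|j m jm]; first exact: cphi.
  by rewrite nc (linear_belowZ (cphi _)); have [_ ->] := bP (k m).
have [d0 /(_ _ jm)] := dP m; rewrite nc (linear_belowZ (cphi _)).
by rewrite -(ler_pM2l (x := (d m)^-1)) ?invr_gt0// mulrBr mulVf ?gt_eqF.
Qed.

End separated_functionals.

(** * A separated family of types, and the continuum *)

Section sup_seminorm.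
Variables (R : realType) (V : lmodType R) (Q : set (V -> R)).
Hypothesis Q0 : Q !=set0.
Hypothesis Q_seminorm : forall q, Q q -> seminorm q.
Hypothesis Q_bounded : forall x, has_ubound [set q x | q in Q].

Definition sup_seminorm x : R := sup [set q x | q in Q].

Lemma le_sup_seminorm q x : Q q -> q x <= sup_seminorm x.
Proof. by move=> Qq; apply: ub_le_sup => //; exists q. Qed.

Lemma sup_seminorm_le x c : (forall q, Q q -> q x <= c) -> sup_seminorm x <= c.
Proof.
move=> H; apply: ge_sup => [|_ [q Qq <-]]; last exact: H.
by have [q Qq] := Q0; exists (q x), q.
Qed.

Lemma sup_seminormP : seminorm sup_seminorm.
Proof.
split=> [x|x y|t x].
- have [q Qq] := Q0; have [q0 _ _] := Q_seminorm Qq.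
  exact: le_trans (q0 x) (le_sup_seminorm x Qq).
- apply: sup_seminorm_le => q Qq; have [_ qD _] := Q_seminorm Qq.
  by apply: le_trans (qD x y) _; apply: lerD; exact: le_sup_seminorm.
have dir s y : sup_seminorm (s *: y) <= `|s| * sup_seminorm y.
  apply: sup_seminorm_le => q Qq; have [_ _ qZ] := Q_seminorm Qq.
  by rewrite qZ ler_wpM2l// le_sup_seminorm.
apply/le_anti; rewrite dir/=; have [->|t0] := eqVneq t 0.
  rewrite normr0 mul0r; have [q Qq] := Q0; have [q0 _ _] := Q_seminorm Qq.
  exact: le_trans (q0 _) (le_sup_seminorm _ Qq).
rewrite -ler_pdivlMl ?normr_gt0// -normfV; apply: le_trans (dir _ _).
by rewrite scalerA mulVf// scale1r.
Qed.

End sup_seminorm.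

Section separated_types.
Variables (R : realType) (E : completeNormedModType R) (n : nat) (i0 : 'I_n).
Variables (psi : nat -> E -> R) (c : nat -> E).
Hypothesis psi_contractive : forall m, contractive (psi m).
Hypothesis psi_norming : forall m, psi m (c m) = `|c m|.
Hypothesis psi_gap : forall j m, j != m -> psi j (c m) <= `|c m| - 1.

Definition lift_functional m (u : formal_ext E n) : R :=
  `|psi m u.1 + u.2 0 i0|.

Definition family (S : set nat) : set (formal_ext E n -> R) :=
  [set fun u => `|u.1| ] `|` [set lift_functional m | m in S].

(** The least type that still dominates every [psi m] with [m] in [S], extended
    by the value [1] at the variable [i0] and [0] at the others. *)
Definition type_of_set S := sup_seminorm (family S).

Lemma family_le S q u : family S q -> q u <= `|u.1| + `|u.2 0 i0|.
Proof.
case=> [->|[m _ <-]]; first by rewrite lerDl.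
apply: le_trans (ler_normD _ _) _; rewrite lerD2r.
exact: linear_below_norm (psi_contractive m) _ (@norm_seminorm _ _).
Qed.

Lemma family_seminorm S q : family S q -> seminorm q.
Proof.
have [_ nD nZ] := @norm_seminorm R E.
case=> [->|[m _ <-]]; first by split=> [u|u w|t u] //=.
split=> [u|u w|t u]; rewrite /lift_functional//=.
  by rewrite (linear_belowD (psi_contractive m)) mxE addrACA ler_normD.
by rewrite (linear_belowZ (psi_contractive m)) mxE -mulrDr normrM.
Qed.

Lemma family_bounded S u : has_ubound [set q u | q in family S].
Proof. by exists (`|u.1| + `|u.2 0 i0|) => _ [q Qq <-]; exact: family_le Qq. Qed.

Lemma family_nonempty S : family S !=set0.
Proof. by exists (fun u => `|u.1|); left. Qed.

Lemma type_of_set_ntype S : ntypes (type_of_set S).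
Proof.
split; first exact: sup_seminormP (family_nonempty S) (@family_seminorm S)
  (@family_bounded S).
move=> b; apply/le_anti/andP; split.
  apply: (sup_seminorm_le (family_nonempty S)) => q /family_le/le_trans; apply.
  by rewrite /= mxE normr0 addr0.
have := le_sup_seminorm (@family_bounded S) (b, 0) (or_introl erefl); exact.
Qed.

Lemma type_of_set_in S m : S m -> `|c m| + 1 <= type_of_set S (c m, delta_mx 0 i0).
Proof.
move=> Sm.
have := le_sup_seminorm (@family_bounded S) (c m, delta_mx 0 i0)
  (or_intror (ex_intro2 _ _ m Sm erefl)).
apply: le_trans; rewrite /lift_functional/= psi_norming mxE !eqxx.
by rewrite ger0_norm// addr_ge0.
Qed.

Lemma type_of_set_notin S m : ~ S m -> type_of_set S (c m, delta_mx 0 i0) <= `|c m|.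
Proof.
move=> Sm; apply: (sup_seminorm_le (family_nonempty S)) => q [->//|[j Sj <-]].
rewrite /lift_functional/= mxE !eqxx ler_norml/=.
have jm : j != m by apply: contra_not_neq Sm => <-.
have := psi_gap jm.
have := linear_below_norm (psi_contractive j) (c m) (@norm_seminorm _ _).
by rewrite ler_norml => /andP[? ?] ?; apply/andP; split; lra.
Qed.

(** Two such types differ by at least [1] at [(c m, delta_mx 0 i0)], so no third
    type is within [1 / 3] of both. *)
Lemma type_of_set_far S S' m (eta : formal_ext E n -> R) : S m -> ~ S' m ->
  (type_dist (type_of_set S) eta < (3^-1)%:E)%E ->
  ~ (type_dist (type_of_set S') eta < (3^-1)%:E)%E.
Proof.
move=> Sm S'm /(type_dist_lt (c m, delta_mx 0 i0)) d.
move=> /(type_dist_lt (c m, delta_mx 0 i0)) d'.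
have := type_of_set_in Sm; have := type_of_set_notin S'm.
move: d d'; rewrite /= l1norm_delta mulr1 !ler_norml => /andP[? ?] /andP[? ?].
by lra.
Qed.

End separated_types.

Lemma card_le_inj (T U : Type) (A : set T) (B : set U) (f : T -> U) :
  {in A &, injective f} -> (forall x, A x -> B (f x)) -> A #<= B.
Proof.
move=> /inj_card_eq fA AB; rewrite -(card_le_eql fA).
by apply: subset_card_le => _ [x Ax <-]; exact: AB.
Qed.

Section continuum.
Variable R : realType.

Lemma lt_ratr_inj (x y : R) : (forall q : rat, (ratr q < x) = (ratr q < y)) -> x = y.
Proof.
have dir a b : (forall q : rat, (ratr q < a) = (ratr q < b)) -> a <= b :> R.
  move=> ab; rewrite leNgt; apply/negP => /rat_in_itvoo[q].
  by rewrite in_itv/= ab => /andP[bq qb]; have := lt_trans bq qb; rewrite ltxx.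
by move=> xy; apply/le_anti; rewrite !dir.
Qed.

Lemma card_real_le_sets : [set: R] #<= [set: set nat].
Proof.
pose cut (x : R) : set nat := [set choice.pickle q | q in [set q : rat | ratr q < x]].
have cutE x (q : rat) : cut x (choice.pickle q) <-> ratr q < x.
  split=> [[q' q'x /(pcan_inj choice.pickleK) <-//]|qx].
  by exists q.
apply: (@card_le_inj _ _ _ _ cut) => // x y _ _ xy; apply: lt_ratr_inj => q.
by apply/idP/idP => /cutE h; apply/cutE; [rewrite -xy|rewrite xy].
Qed.

(** Base three leaves no room for two expansions with digits [0] and [1] of the
    same number. *)
Definition ternary (S : set nat) (k : nat) : R :=
  \sum_(i < k) (val i \in S)%:R * 3^-1 ^+ i.

Definition ternary_value S : R := sup (range (ternary S)).

Lemma ternaryS S k : ternary S k.+1 = ternary S k + (k \in S)%:R * 3^-1 ^+ k.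
Proof. by rewrite /ternary big_ord_recr. Qed.

(** The tail after [k] digits is at most the geometric series starting at
    [3^-1 ^+ k], which sums to [3 / 2] times its first term. *)
Lemma ternary_upper S k l : ternary S l <= ternary S k + 3 / 2 * 3^-1 ^+ k.
Proof.
have pos i : 0 <= 3^-1 ^+ i :> R by rewrite exprn_ge0.
have up : nondecreasing_seq (ternary S).
  by apply/nondecreasing_seqP => i; rewrite ternaryS lerDl mulr_ge0.
have down : nonincreasing_seq (fun i => ternary S i + 3 / 2 * 3^-1 ^+ i).
  apply/nonincreasing_seqP => i; rewrite ternaryS exprS.
  have : (i \in S)%:R * 3^-1 ^+ i <= 3^-1 ^+ i :> R.
    by rewrite ler_piMl// lern1 leq_b1.
  lra.
have [kl|/ltnW lk] := leqP k l.
  by apply: le_trans (down _ _ kl); rewrite lerDl mulr_ge0.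
by apply: le_trans (up _ _ lk) _; rewrite lerDl mulr_ge0.
Qed.

Lemma ternary_has_ubound S : has_ubound (range (ternary S)).
Proof.
by exists (ternary S 0 + 3 / 2 * 3^-1 ^+ 0) => _ [l _ <-]; exact: ternary_upper.
Qed.

Lemma ternary_value_lt S S' m : m \in S -> m \notin S' ->
  (forall i, (i < m)%N -> (i \in S) = (i \in S')) ->
  ternary_value S' < ternary_value S.
Proof.
move=> mS mS' same; apply: (@lt_le_trans _ _ (ternary S m.+1)); last first.
  by apply: ub_le_sup; [exact: ternary_has_ubound|exists m.+1].
apply: (@le_lt_trans _ _ (ternary S' m.+1 + 3 / 2 * 3^-1 ^+ m.+1)).
  apply: ge_sup => [|_ [l _ <-]]; last exact: ternary_upper.
  by exists (ternary S' 0), 0%N.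
rewrite !ternaryS mS (negbTE mS') exprS mul0r mul1r.
have -> : ternary S' m = ternary S m.
  by apply: eq_bigr => i _; rewrite (same i (ltn_ord i)).
have : 0 < 3^-1 ^+ m :> R by rewrite exprn_gt0.
by lra.
Qed.

Lemma ternary_value_inj : injective ternary_value.
Proof.
move=> S S' SS'; apply: contrapT => neq.
have ex : exists m, (m \in S) != (m \in S').
  apply: contrapT => no; apply: neq; apply/seteqP.
  have eqm m : (m \in S) = (m \in S').
    by apply/eqP/negPn/negP => mm; apply: no; exists m.
  by split=> m /mem_set mm; apply/set_mem; [rewrite -eqm|rewrite eqm].
have mfirst m : (m < ex_minn ex)%N -> (m \in S) = (m \in S').
  by case: ex_minnP => k _ kmin mk; apply/eqP/negPn/negP => /kmin; rewrite leqNgt mk.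
case: ex_minnP mfirst => m mm _ mfirst; move: mm.
case mS : (m \in S); case mS' : (m \in S') => // _.
  by have := ternary_value_lt mS (negbT mS') mfirst; rewrite SS' ltxx.
have := ternary_value_lt mS' (negbT mS) (fun i im => esym (mfirst i im)).
by rewrite SS' ltxx.
Qed.

Lemma card_sets_le_real : [set: set nat] #<= [set: R].
Proof.
by apply: (@card_le_inj _ _ _ _ ternary_value) => // S S' _ _ /ternary_value_inj.
Qed.

End continuum.

(** * The number of types *)

Section number_of_types.
Variables (R : realType) (E : completeNormedModType R) (n : nat).
Implicit Types (xi zeta : formal_ext E n -> R).

Lemma type_eq_dense xi zeta (D : set E) : dense D -> ntypes xi -> ntypes zeta ->
  (forall d (l : 'rV[rat]_n), D d -> xi (d, map_mx ratr l) = zeta (d, map_mx ratr l)) ->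
  xi = zeta.
Proof.
move=> dD txi tzeta same; apply/funext => -[b l].
have bound (z : formal_ext E n -> R) : ntypes z -> exists2 M, 0 <= M &
    forall i, z (0, delta_mx 0 i) <= M.
  move=> [[z0 _ _] _]; exists (\sum_i z (0, delta_mx 0 i)); first exact: sumr_ge0.
  by move=> i; rewrite (bigD1 i)//= lerDl sumr_ge0.
have [M M0 xiM] := bound _ txi; have [M' M'0 zetaM'] := bound _ tzeta.
apply/eqP; rewrite -subr_eq0 -normr_le0; apply/ler_addgt0Pr => e e0; rewrite add0r.
have e4 : 0 < e / 4 by rewrite divr_gt0.
have [d [bd Dd]] : ball b (e / 4) `&` D !=set0.
  by apply: dD; [exists b; exact: ballxx|exact: ball_open].
pose eta := e / 4 / ((M + M') * n%:R + 1).
have P0 : 0 < (M + M') * n%:R + 1 by rewrite ltr_wpDl// mulr_ge0// addr_ge0.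
have eta0 : 0 < eta by rewrite divr_gt0.
have /choice[q qP] : forall i, exists q : rat, `|l 0 i - ratr q| <= eta.
  move=> i; have /rat_in_itvoo[q] : l 0 i - eta < l 0 i + eta by lra.
  rewrite in_itv/= => /andP[q1 q2]; exists q.
  by rewrite ler_norml; apply/andP; split; lra.
pose l' : 'rV[R]_n := map_mx ratr (\row_i q i).
have ll' : l1norm (l - l') <= n%:R * eta.
  rewrite mulr_natl -[X in _ *+ X]card_ord -sumr_const ler_sum// => i _.
  by rewrite !mxE.
have small : (M + M') * l1norm (l - l') <= e / 4.
  apply: (@le_trans _ _ ((M + M') * (n%:R * eta))).
    by rewrite ler_wpM2l// addr_ge0.
  rewrite mulrA /eta mulrA ler_pdivrMr// mulrC ler_pM2l// lerDl//.
move: bd; rewrite -ball_normE/= => bd.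
have h := type_lipschitz b d l l' txi xiM.
have h' := type_lipschitz b d l l' tzeta zetaM'.
have := same d (\row_i q i) Dd; rewrite -/l' => s; rewrite s in h.
apply: le_trans (ler_distD (zeta (d, l')) _ _) _.
rewrite [X in _ + X]distrC; move: small; rewrite mulrDl.
move: h h' bd; set A := `|_|; set B := `|_|; set C := `|_|.
set X := M * _; set Y := M' * _; lra.
Qed.

(** A type is encoded by the rational lower cuts of its values at the points
    with first component in a countable dense set and rational coefficients. *)
Lemma card_types_le_real : separable_space E -> @ntypes R E n #<= [set: R].
Proof.
move=> [D /countable_injP[g ginj] dD].
apply: card_le_trans (card_sets_le_real R).
pose cut xi : set nat := [set k | exists d (l : 'rV[rat]_n) (q : rat),
  [/\ D d, k = choice.pickle (g d, l, q) & ratr q < xi (d, map_mx ratr l)]].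
have cutE xi d (l : 'rV[rat]_n) (q : rat) : D d ->
    cut xi (choice.pickle (g d, l, q)) <-> ratr q < xi (d, map_mx ratr l).
  move=> Dd; split=> [[d' [l' [q' [Dd' /(pcan_inj choice.pickleK)]]]]|qx].
    by move=> [gd -> ->]; rewrite (ginj _ _ _ _ gd) ?inE.
  by exists d, l, q.
apply: (@card_le_inj _ _ _ _ cut) => // xi zeta /set_mem txi /set_mem tzeta same.
apply: (type_eq_dense dD txi tzeta) => d l Dd; apply: lt_ratr_inj => q.
by apply/idP/idP => /(cutE _ _ _ _ Dd) h; apply/(cutE _ _ _ _ Dd);
  [rewrite -same|rewrite same].
Qed.

Lemma type_dist_refl xi : ntypes xi -> (type_dist xi xi <= 0)%E.
Proof.
move=> txi; apply: type_dist_le => // u.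
by rewrite subrr normr0 mul0r.
Qed.

Lemma card_real_le_dense D : (0 < n)%N -> separable_space E ->
  ~ (finite_dimensional E /\ polyhedral E) ->
  metrically_dense (@ntypes R E n) (@type_dist R E n) D -> [set: R] #<= D.
Proof.
move=> n0 sepE npoly [_ dD]; pose i0 := Ordinal n0.
have [psi [c [psiC psiN psi_gap]]] := separated_functionals sepE npoly.
have /choice[near_type nearP] : forall S, exists eta, D eta /\
    (type_dist (type_of_set i0 psi S) eta < (3^-1)%:E)%E.
  move=> S; have [|eta Deta] := dD _ (type_of_set_ntype i0 psiC S) 3^-1.
    by rewrite invr_gt0.
  by exists eta.
apply: card_le_trans (card_real_le_sets R) _.
apply: (@card_le_inj _ _ _ _ near_type) => [S S' _ _ SS'|S _]; last first.
  by have [] := nearP S.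
have [_ dS] := nearP S; have [_ dS'] := nearP S'; rewrite -SS' in dS'.
apply/seteqP; split=> m Sm; apply: contrapT => nSm.
  exact: (type_of_set_far psiC psiN psi_gap Sm nSm dS dS').
exact: (type_of_set_far psiC psiN psi_gap Sm nSm dS' dS).
Qed.

Lemma types_density_character : (0 < n)%N -> separable_space E ->
  ~ (finite_dimensional E /\ polyhedral E) ->
  metric_density_character_is (@ntypes R E n) (@type_dist R E n) [set: R].
Proof.
move=> n0 sepE npoly.
have all_dense : metrically_dense (@ntypes R E n) (@type_dist R E n) (@ntypes R E n).
  split=> // xi txi e e0; exists xi => //.
  by apply: le_lt_trans (type_dist_refl txi) _; rewrite lte_fin.
split=> [|D]; last exact: card_real_le_dense.
exists (@ntypes R E n) => //.
by rewrite card_eq_le card_types_le_real// card_real_le_dense.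
Qed.

End number_of_types.

Theorem theorem7p1 (R : realType) (E : completeNormedModType R)
    (Esep : separable_space E) :
  (finite_dimensional E /\ polyhedral E ->
     forall n : nat,
       metrically_separable (@ntypes R E n) (@type_dist R E n)) /\
  (~ (finite_dimensional E /\ polyhedral E) ->
     forall n : nat, (1 <= n)%N ->
       metric_density_character_is (@ntypes R E n) (@type_dist R E n)
         [set: R]%classic).
Proof.
split=> [[_ [m [v ballE]]] n|npoly n n0].
  exact: types_metrically_separable ballE.
exact: types_density_character.
Qed.
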